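(* Let $A$ be a supercyclic Banach algebra of dimension $>1$. Then $A$ is infinite dimensional, radical and weakly amenable.
   Context: A Banach algebra is a complex algebra $A$, possibly without unit, equipped with a complete norm satisfying $\|ab\|\le\|a\|\,\|b\|$. $A$ is supercyclic if there is $a\in A$ such that $\{za^n: z\in\mathbb C,\ n\in\mathbb N\}$ is dense in $A$ ($\mathbb N$ = positive integers). $A$ is radical if it coincides with its Jacobson radical. $A$ is weakly amenable if every continuous derivation $D:A\to A^*$ (i.e. $D(ab)=(Da)b+a(Db)$, with the natural Banach $A$-bimodule structure on the dual $A^*$) has the form $Da=ax-xa$ for some $x\in A^*$. *)

(* Defs.v *)
From HB Require Import structures.
From mathcomp Require Import all_boot all_order all_algebra.
From mathcomp Require Import complex.
From mathcomp Require Import all_classical all_reals all_analysis.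
Set Implicit Arguments. Unset Strict Implicit. Unset Printing Implicit Defensive.
Import Order.TTheory GRing.Theory Num.Theory.
Import numFieldNormedType.Exports.
Local Open Scope classical_set_scope.
Local Open Scope ring_scope.
Local Open Scope complex_scope.

Section BA.
Variables (R : realType) (V : completeNormedModType R[i]) (mul : V -> V -> V).

Definition is_banach_algebra : Prop :=
  [/\ (forall a b c, mul a (mul b c) = mul (mul a b) c),
      (forall a b c, mul (a + b) c = mul a c + mul b c),
      (forall a b c, mul a (b + c) = mul a b + mul a c),
      (forall (z : R[i]) a b, mul (z *: a) b = z *: mul a b) &
      (forall (z : R[i]) a b, mul a (z *: b) = z *: mul a b)]
  /\ (forall a b, `|mul a b| <= `|a| * `|b|).

(* a ^ n for n >= 1 :  apow a n = a^(n+1) *)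
Fixpoint apow (a : V) (n : nat) : V :=
  if n is m.+1 then mul a (apow a m) else a.

Definition supercyclic : Prop :=
  exists a : V, dense [set x | exists (z : R[i]) (n : nat),
                                 (0 < n)%N /\ x = z *: apow a n.-1].

Definition lin_indep (n : nat) (v : 'I_n -> V) : Prop :=
  forall c : 'I_n -> R[i], \sum_(i < n) c i *: v i = 0 -> forall i, c i = 0.

Definition dim_gt1 : Prop := exists v : 'I_2 -> V, lin_indep v.

Definition infinite_dim : Prop := forall n, exists v : 'I_n -> V, lin_indep v.

Definition left_ideal (L : set V) : Prop :=
  [/\ L 0, (forall x y, L x -> L y -> L (x + y)),
      (forall (z : R[i]) x, L x -> L (z *: x)) &
      (forall a x, L x -> L (mul a x))].

Definition modular_left_ideal (L : set V) : Prop :=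
  left_ideal L /\ exists u, forall a, L (a - mul a u).

Definition maximal_modular_left_ideal (L : set V) : Prop :=
  [/\ modular_left_ideal L, L != setT &
      forall M, left_ideal M -> L `<=` M -> M != setT -> M = L].

(* Jacobson radical: intersection of all maximal modular left ideals
   (= A if there are none) *)
Definition jacobson_radical : set V :=
  [set a | forall L, maximal_modular_left_ideal L -> L a].

Definition radical : Prop := jacobson_radical = setT.

(* continuous derivations A -> A^*, written D a b = (D a)(b).
   The dual module structure: (a.f)(b) = f(b a), (f.a)(b) = f(a b).
   D is linear; each D a is linear; D is continuous A -> A^* (norm topology),
   i.e. bounded: |D a b| <= M ||a|| ||b||. *)
Definition cont_derivation (D : V -> V -> R[i]) : Prop :=
  [/\ (forall a a' b, D (a + a') b = D a b + D a' b),
      (forall (z : R[i]) a b, D (z *: a) b = z * D a b),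
      (forall a b b', D a (b + b') = D a b + D a b') &
      (forall (z : R[i]) a b, D a (z *: b) = z * D a b)]
  /\ (exists M : R, forall a b, `|D a b| <= (M%:C) * `|a| * `|b|)
  /\ (forall a b c, D (mul a b) c = D a (mul b c) + D b (mul c a)).

Definition dual_elt (x : V -> R[i]) : Prop :=
  [/\ (forall b b', x (b + b') = x b + x b'),
      (forall (z : R[i]) b, x (z *: b) = z * x b) &
      (exists M : R, forall b, `|x b| <= M%:C * `|b|)].

(* inner: D a = a.x - x.a *)
Definition weakly_amenable : Prop :=
  forall D, cont_derivation D ->
    exists x, dual_elt x /\ forall a c, D a c = x (mul c a) - x (mul a c).

End BA.

(* Main.v *)
(* Let a be a supercyclic vector; A is commutative, and since dim A > 1 the
   elements z a^n with n arbitrarily large are already dense.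

   Weak amenability: for a derivation D, (D a^n)(a) = n (D a)(a^n), so on the
   elements z a^n the functional D a is O(1/n); hence D a = 0 and D = 0.

   Radical: suppose J is a proper modular ideal with modular unit u. If 1 - w a
   were invertible modulo J for all w, averaging the resolvents over n-th roots
   of unity and comparing the radii |w| and (1 + 1/2n)|w| would give
   |x (1 - x)^-2| = O(1/n) modulo J for x = (w a)^n, which is absurd for
   x = z a^n close to u. So some b = w a satisfies b = 1 modulo a proper ideal;
   this yields a character phi with phi b = 1, and {b^n} is dense in {phi = 1}.
   Every other 1 - w b is invertible, and the same averages show that
   (1 - (2b)^n)^-1 converges; the limit gives a unit e of A. An element x with
   phi x <> 0 is then invertible. If b^n is close to e, the contraction principle
   provides an n-th root p of b^n with |p - e| <= 1/4n and phi p = 1; since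
   b^n - p^n = (b - p) Z with phi Z = n, b = p. As n is arbitrarily large, b = e,
   contradicting dim A > 1.

   Infinite dimension: a linear dependency between powers of a gives
   a^k = a^k q, and as 1 - q is invertible modulo no proper ideal, a^k = 0. *)
Require Import Defs.
From HB Require Import structures.
From mathcomp Require Import all_boot all_order all_algebra.
From mathcomp Require Import cyclic cyclotomic separable.
From mathcomp Require Import complex ring lra.
From mathcomp Require Import all_classical all_reals all_analysis.
Set Implicit Arguments. Unset Strict Implicit. Unset Printing Implicit Defensive.
Import Order.TTheory GRing.Theory Num.Theory.
Import numFieldNormedType.Exports.
Local Open Scope classical_set_scope.
Local Open Scope complex_scope.
Local Open Scope ring_scope.

(** * Real-valued norms, compactness and completeness *)

(* Norms of complex normed spaces take values in [R[i]]; their real parts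
   live in an ordered field. *)
Definition nrm (R : realType) (W : normedZmodType R[i]) (x : W) : R :=
  complex.Re `|x|.

Section RealNorm.
Variable R : realType.

Lemma nrmE (W : normedZmodType R[i]) (x : W) : `|x| = (nrm x)%:C.
Proof. by rewrite /nrm RRe_real // ger0_real. Qed.

Lemma nrm_ge0 (W : normedZmodType R[i]) (x : W) : 0 <= nrm x.
Proof. by rewrite -ler0c -nrmE. Qed.

Lemma nrm0 (W : normedZmodType R[i]) : nrm (0 : W) = 0.
Proof. by rewrite /nrm normr0. Qed.

Lemma nrmN (W : normedZmodType R[i]) (x : W) : nrm (- x) = nrm x.
Proof. by rewrite /nrm normrN. Qed.

Lemma nrmD (W : normedZmodType R[i]) (x y : W) : nrm (x + y) <= nrm x + nrm y.
Proof. by rewrite -lecR rmorphD /= -!nrmE ler_normD. Qed.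

Lemma nrm_distC (W : normedZmodType R[i]) (x y : W) : nrm (x - y) = nrm (y - x).
Proof. by rewrite -nrmN opprB. Qed.

Lemma nrm0_eq0 (W : normedZmodType R[i]) (x : W) : nrm x = 0 -> x = 0.
Proof. by move=> x0; apply: normr0_eq0; rewrite nrmE x0. Qed.

Lemma nrm_gt0 (W : normedZmodType R[i]) (x : W) : (0 < nrm x) = (x != 0).
Proof.
rewrite lt_def nrm_ge0 andbT; congr (~~ _); apply/eqP/eqP => [/nrm0_eq0 //|->].
exact: nrm0.
Qed.

Lemma nrm_small_eq0 (W : normedZmodType R[i]) (x : W) :
  (forall eps, 0 < eps -> nrm x < eps) -> x = 0.
Proof.
move=> xs; apply: nrm0_eq0; apply/eqP; rewrite eq_le nrm_ge0 andbT leNgt.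
by apply/negP => /xs; rewrite ltxx.
Qed.

Lemma nrmZ (V : normedModType R[i]) (z : R[i]) (x : V) :
  nrm (z *: x) = nrm z * nrm x.
Proof. by apply: complexI; rewrite rmorphM /= -!nrmE normrZ. Qed.

Lemma nrmM (z w : R[i]) : nrm (z * w) = nrm z * nrm w.
Proof. by apply: complexI; rewrite rmorphM /= -!nrmE normrM. Qed.

Lemma nrm_real (r : R) : nrm (r%:C : R[i]) = `|r|.
Proof. by rewrite /nrm normc_def /= expr0n /= addr0 sqrtr_sqr. Qed.

Lemma nrm1 : nrm (1 : R[i]) = 1.
Proof. by rewrite /nrm normr1. Qed.

Lemma nrm_nat n : nrm (n%:R : R[i]) = n%:R.
Proof. by rewrite -(rmorph_nat (real_complex R)) nrm_real normr_nat. Qed.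

Lemma nrmX (z : R[i]) n : nrm (z ^+ n) = nrm z ^+ n.
Proof.
elim: n => [|n IH]; first by rewrite !expr0 nrm1.
by rewrite !exprS nrmM IH.
Qed.

Lemma nrmV (z : R[i]) : nrm z^-1 = (nrm z)^-1.
Proof.
have [->|z0] := eqVneq z 0; first by rewrite invr0 !nrm0 invr0.
have nz0 : nrm z != 0 by rewrite gt_eqF // nrm_gt0.
by apply: (mulIf nz0); rewrite -nrmM !mulVf // nrm1.
Qed.

Lemma nrm_Re_le (z : R[i]) : `|complex.Re z| <= nrm z.
Proof. by rewrite -lecR -nrmE normc_ge_Re. Qed.

Lemma nrm_Im_le (z : R[i]) : `|complex.Im z| <= nrm z.
Proof.
have := nrm_Re_le (z * 'i); rewrite nrmM ReiNIm normrN.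
suff -> : nrm ('i : R[i]) = 1 by rewrite mulr1.
by rewrite /nrm normc_def /= expr0n expr1n add0r sqrtr1.
Qed.

Lemma nrm_le_ReIm (s t : R) : nrm (s +i* t) <= `|s| + `|t|.
Proof.
have -> : s +i* t = s%:C + t%:C * 'i by simpc.
rewrite (le_trans (nrmD _ _)) // nrmM !nrm_real.
suff -> : nrm ('i : R[i]) = 1 by rewrite mulr1.
by rewrite /nrm normc_def /= expr0n expr1n add0r sqrtr1.
Qed.

(* Compactness of the disk, read off from that of a square of [R * R]. *)
Lemma locally_bounded_disk (f : R[i] -> R) :
  (forall w, exists d, 0 < d /\ exists M, forall w', nrm (w' - w) < d -> f w' <= M) ->
  forall r, exists M, forall w, nrm w <= r -> f w <= M.
Proof.
move=> floc r.
pose P (M : R) (st : R * R) := f (st.1 +i* st.2) <= M.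
have cK : compact (`[- r, r] `*` `[- r, r] : set (R * R)).
  by apply: compact_setX; exact: segment_compact.
(* The near-covering form of compactness, along the filter of large bounds [M], turns bounds near
   each point into one bound on the square. *)
have /compact_near_coveringP/(_ R (+oo)%R P _) := cK.
case=> [[s t] _|M [_ HM]].
  have [d [d0 [M fM]]] := floc (s +i* t).
  have d20 : 0 < d / 2 by rewrite divr_gt0.
  exists (ball s (d / 2) `*` ball t (d / 2), [set M' | M < M']).
    split => /=; last by exists M; split => //; rewrite num_real.
    by exists (ball s (d / 2), ball t (d / 2)) => //=; split; exact: nbhsx_ballx.
  move=> [[s' t'] M'] [/= [sd td] MM']; rewrite /P /=.
  apply: le_trans (ltW MM'); apply: fM.
  have -> : s' +i* t' - (s +i* t) = (s' - s) +i* (t' - t) by simpc.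
  apply: le_lt_trans (nrm_le_ReIm _ _) _.
  rewrite [d]splitr ltrD // distrC; [exact: sd|exact: td].
exists (M + 1) => w wr.
have := HM (M + 1) _ (complex.Re w, complex.Im w).
rewrite /P /=; have -> : complex.Re w +i* complex.Im w = w by case: w {wr}.
apply; first by rewrite ltrDl.
by split; rewrite /= in_itv /= -ler_norml; apply: le_trans wr;
  [exact: nrm_Re_le|exact: nrm_Im_le].
Qed.

Lemma expr_eventually_small (k eps : R) : 0 <= k < 1 -> 0 < eps ->
  exists N, forall n, (N <= n)%N -> k ^+ n < eps.
Proof.
move=> /andP[k0 k1] e0.
have /cvgrPdist_lt/(_ eps e0) [N _ HN] : (k ^+ n) @[n --> \oo] --> 0%R.
  by apply: cvg_expr; rewrite ger0_norm.
exists N => n Nn; have := HN n Nn.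
by rewrite sub0r normrN ger0_norm // exprn_ge0.
Qed.

Lemma exists_nat_gt (x : R) : exists n : nat, x < n%:R.
Proof. by exists (Num.truncn x).+1; rewrite truncnS_gt. Qed.

End RealNorm.

Section Complete.
Variables (R : realType) (V : completeNormedModType R[i]).

Lemma cauchy_limit (u : nat -> V) :
  (forall eps, 0 < eps ->
     exists N, forall n m, (N <= n)%N -> (N <= m)%N -> nrm (u n - u m) < eps) ->
  exists l, forall eps, 0 < eps ->
     exists N, forall n, (N <= n)%N -> nrm (u n - l) < eps.
Proof.
move=> uC.
have : cauchy (u @ \oo).
  apply/cauchy_ballP => e e0.
  have ee : e = (complex.Re e)%:C by rewrite RRe_real // gtr0_real.
  have re0 : 0 < complex.Re e by rewrite -ltcR -ee.
  have [N HN] := uC _ re0.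
  pose B := [set x | exists2 n, (N <= n)%N & x = u n].
  have FB : (u @ \oo) B by exists N => //= n Nn; exists n.
  exists (B, B) => //= -[_ _] [/= [n Nn ->] [m Nm ->]].
  by rewrite /= -ball_normE /= ee nrmE ltcR HN.
move=> /cauchy_cvgP /cvg_ex[l ul]; exists l => eps eps0.
have eC0 : 0 < eps%:C :> R[i] by rewrite ltcR.
have [N _ HN] := (cvgrPdist_lt _ _).1 ul _ eC0.
exists N => n Nn; have := HN n Nn.
by rewrite /= nrmE ltcR nrm_distC.
Qed.

(** Banach's fixed point theorem on a closed set [P] containing 0: the iterates of 0 form a Cauchy
    sequence. Closedness is stated by approximation, so [P] may be a ball inside a closed ideal. *)
Lemma contraction_fixpoint (P : V -> Prop) (f : V -> V) (k : R) :
  0 <= k < 1 -> P 0 -> (forall x, P x -> P (f x)) ->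
  (forall x, (forall eps, 0 < eps -> exists y, P y /\ nrm (x - y) < eps) -> P x) ->
  (forall x y, P x -> P y -> nrm (f x - f y) <= k * nrm (x - y)) ->
  exists x, P x /\ f x = x.
Proof.
move=> /andP[k0 k1] P0 Pf Pcl flip.
pose u n := iter n f 0.
have Pu n : P (u n) by elim: n => //= n; exact: Pf.
pose d := nrm (f 0).
have step n : nrm (u n.+1 - u n) <= k ^+ n * d.
  elim: n => [|n IH]; first by rewrite /u /= subr0 expr0 mul1r.
  apply: le_trans (flip _ _ (Pu n.+1) (Pu n)) _.
  by rewrite exprS -mulrA ler_wpM2l.
have k10 : 0 < 1 - k by rewrite subr_gt0.
have tail n m : nrm (u (n + m)%N - u n) <= k ^+ n * d / (1 - k).
  have d0 : 0 <= d by exact: nrm_ge0.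
  (* The factor 1 - k^m, coming from the partial geometric sum, lets the induction on [m] close. *)
  suff : nrm (u (n + m)%N - u n) <= k ^+ n * d * (1 - k ^+ m) / (1 - k).
    move/le_trans; apply; rewrite ler_pM2r ?invr_gt0 //.
    by rewrite ler_piMr ?mulr_ge0 ?exprn_ge0 // gerBl exprn_ge0.
  elim: m => [|m IH]; first by rewrite addn0 subrr nrm0 expr0 subrr mulr0 mul0r.
  rewrite addnS; have -> : u (n + m).+1 - u n =
    (u (n + m).+1 - u (n + m)%N) + (u (n + m)%N - u n) by rewrite subrKA.
  apply: le_trans (nrmD _ _) _; apply: le_trans (lerD (step _) IH) _.
  rewrite le_eqVlt; apply/orP; left; apply/eqP.
  by rewrite exprD exprS; field; rewrite gt_eqF.
have [l ul] : exists l, forall eps, 0 < eps ->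
     exists N, forall n, (N <= n)%N -> nrm (u n - l) < eps.
  apply: cauchy_limit => eps eps0.
  have d1 : 0 < d + 1 by rewrite ltr_wpDl // nrm_ge0.
  have e1 : 0 < eps * (1 - k) / 2 / (d + 1) by rewrite !divr_gt0 // mulr_gt0.
  have [N HN] := expr_eventually_small (introT andP (conj k0 k1)) e1.
  have close n : (N <= n)%N -> nrm (u n - u N) < eps / 2.
    move=> Nn; rewrite -(subnKC Nn); apply: le_lt_trans (tail _ _) _.
    have := HN N (leqnn N); rewrite ltr_pdivlMr // => kN.
    rewrite ltr_pdivrMr // mulrAC; apply: le_lt_trans kN.
    by rewrite ler_wpM2l ?exprn_ge0 // lerDl.
  exists N => n m Nn Nm; have -> : u n - u m = (u n - u N) - (u m - u N).
    by rewrite opprB subrKA.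
  apply: le_lt_trans (nrmD _ _) _; rewrite nrmN [eps]splitr.
  by rewrite ltrD ?close.
have Pl : P l.
  apply: Pcl => eps /ul[N HN]; exists (u N); split => //.
  by rewrite nrm_distC HN.
exists l; split => //; apply/subr0_eq/nrm_small_eq0 => eps eps0.
have e2 : 0 < eps / 2 by rewrite divr_gt0.
have [N HN] := ul _ e2.
have -> : f l - l = (f l - f (u N)) + (u N.+1 - l) by rewrite /u /= subrKA.
apply: le_lt_trans (nrmD _ _) _; rewrite [eps]splitr ler_ltD ?HN //.
apply: le_trans (flip _ _ Pl (Pu N)) _; rewrite nrm_distC.
apply: le_trans (_ : 1 * nrm (u N - l) <= _).
  by rewrite ler_wpM2r ?nrm_ge0 ?ltW.
by rewrite mul1r ltW ?HN.
Qed.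

End Complete.

(** * Averaging resolvents over roots of unity *)

(** X^n - 1 is separable in characteristic 0, so it has n distinct roots, and n distinct n-th roots
    of unity include a primitive one. *)
Lemma closed_prim_root_exists (F : numClosedFieldType) n :
  (0 < n)%N -> exists z : F, n.-primitive_root z.
Proof.
move=> n0; pose p : {poly F} := 'X^n - 1.
have [r Dp] := closed_field_poly_normal p.
rewrite (monicP _) ?monicXnsubC // scale1r in Dp.
have rn1 : all n.-unity_root r by apply/allP=> z; rewrite -root_prod_XsubC -Dp.
have sz_r : (n < (size r).+1)%N.
  by rewrite -(size_prod_XsubC r id) -Dp size_XnsubC.
have [|z] := hasP (has_prim_root n0 rn1 _ sz_r); last by exists z.
by rewrite -separable_prod_XsubC -Dp separable_Xn_sub_1 // pnatr_eq0 -lt0n.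
Qed.

Lemma sum_prim_root_expr (F : fieldType) n (z : F) k :
  n.-primitive_root z -> (k < n)%N ->
  \sum_(j < n) z ^+ (j * k) = if k == 0%N then n%:R else 0.
Proof.
move=> zn kn; case: eqP => [->|/eqP k0].
  under eq_bigr do rewrite muln0 expr0.
  by rewrite sumr_const card_ord.
have zk1 : z ^+ k - 1 != 0.
  rewrite subr_eq0 -(prim_order_dvd zn).
  by apply/negP => /dvdn_leq; rewrite lt0n k0 leqNgt kn => /(_ isT).
apply: (mulfI zk1); rewrite mulr0.
under eq_bigr do rewrite mulnC exprM.
by rewrite -subrX1 -exprM mulnC exprM (prim_expr_order zn) expr1n subrr.
Qed.

(** A seminorm rather than a norm, so that a quotient norm can be used on the unitization itself;
    equations in the quotient then read [N (x - y) = 0]. *)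
Record alg_seminorm (R : realType) (U : comAlgType R[i]) (N : U -> R) : Prop :=
  AlgSeminorm {
    asn_ge0 : forall x, 0 <= N x;
    asnD : forall x y, N (x + y) <= N x + N y;
    asnZ : forall (z : R[i]) x, N (z *: x) = nrm z * N x;
    asnM : forall x y, N (x * y) <= N x * N y }.

Section Seminorm.
Variables (R : realType) (U : comAlgType R[i]) (N : U -> R).
Hypothesis NP : alg_seminorm N.

Lemma asn0 : N 0 = 0.
Proof. by rewrite -(scale0r (0 : U)) (asnZ NP) nrm0 mul0r. Qed.

Lemma asnN x : N (- x) = N x.
Proof. by rewrite -scaleN1r (asnZ NP) nrmN nrm1 mul1r. Qed.

Lemma asn_distC x y : N (x - y) = N (y - x).
Proof. by rewrite -asnN opprB. Qed.

Lemma asn_sum (I : finType) (F : I -> U) : N (\sum_i F i) <= \sum_i N (F i).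
Proof.
elim/big_ind2: _ => [|x r y s xr ys|//]; first by rewrite asn0.
by rewrite (le_trans (asnD NP _ _)) // lerD.
Qed.

Lemma asn_mul_eq0 x y : N x = 0 -> N (x * y) = 0.
Proof.
move=> x0; apply/eqP; rewrite eq_le (asn_ge0 NP) andbT.
by rewrite (le_trans (asnM NP _ _)) // x0 mul0r.
Qed.

Lemma asn_add_eq0 x y : N x = 0 -> N y = 0 -> N (x + y) = 0.
Proof.
move=> x0 y0; apply/eqP; rewrite eq_le (asn_ge0 NP) andbT.
by rewrite (le_trans (asnD NP _ _)) // x0 y0 addr0.
Qed.

Lemma asn_sub_eq0 x y : N x = 0 -> N y = 0 -> N (x - y) = 0.
Proof. by move=> x0 y0; apply: asn_add_eq0; rewrite ?asnN. Qed.

Lemma asn_congr x y : N (x - y) = 0 -> N x = N y.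
Proof.
have le z t : N (z - t) = 0 -> N z <= N t.
  by move=> zt; rewrite -(subrK t z) (le_trans (asnD NP _ _)) // zt add0r.
by move=> xy; apply/eqP; rewrite eq_le !le // asn_distC.
Qed.

Lemma asn_average (I : finType) (F : I -> U) C :
  (0 < #|I|)%N -> (forall i, N (F i) <= C) ->
  N ((#|I|%:R : R[i])^-1 *: \sum_i F i) <= C.
Proof.
move=> I0 FC; rewrite (asnZ NP) nrmV nrm_nat mulrC ler_pdivrMr ?ltr0n //.
apply: le_trans (asn_sum _) _; apply: le_trans (ler_sum _ (fun i _ => FC i)) _.
by rewrite sumr_const mulr_natr.
Qed.

(** The resolvent identity, up to an [N]-null error because [g] and [g'] are inverses only modulo
    the kernel of [N]. *)
Lemma resolvent_sub a w w' g g' :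
  N ((1 - w *: a) * g - 1) = 0 -> N ((1 - w' *: a) * g' - 1) = 0 ->
  N (g - g' - (w - w') *: (a * g * g')) = 0.
Proof.
move=> gw gw'.
have -> : g - g' - (w - w') *: (a * g * g') =
   ((1 - w *: a) * g - 1) * g' - ((1 - w' *: a) * g' - 1) * g.
  by rewrite -![_ *: a]mulr_algl -[(w - w') *: _]mulr_algl scalerBl; ring.
by apply: asn_sub_eq0; apply: asn_mul_eq0.
Qed.

Lemma resolvent_sub_le a w w' g g' C : N g <= C -> N g' <= C ->
  N ((1 - w *: a) * g - 1) = 0 -> N ((1 - w' *: a) * g' - 1) = 0 ->
  N (g - g') <= nrm (w - w') * (N a * C ^+ 2).
Proof.
move=> gC g'C gw gw'; rewrite (asn_congr (resolvent_sub gw gw')) (asnZ NP).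
rewrite ler_wpM2l ?nrm_ge0 // (le_trans (asnM NP _ _)) // expr2 mulrA.
rewrite ler_pM ?(asn_ge0 NP) // (le_trans (asnM NP _ _)) //.
by rewrite ler_wpM2l ?(asn_ge0 NP).
Qed.

(* 1 / (1 - X ^ n) is the average of the 1 / (1 - om ^ j X). *)
Lemma resolvent_average n (om : R[i]) a w (g : R[i] -> U) :
  n.-primitive_root om ->
  (forall j, N ((1 - (om ^+ j * w) *: a) * g (om ^+ j * w) - 1) = 0) ->
  N ((1 - w ^+ n *: a ^+ n) * (n%:R^-1 *: \sum_(j < n) g (om ^+ j * w)) - 1) = 0.
Proof.
move=> omn gP; have n0 := prim_order_gt0 omn.
have nz : (n%:R : R[i]) != 0 by rewrite pnatr_eq0 -lt0n.
pose X := w *: a.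
have geo j : 1 - w ^+ n *: a ^+ n =
    (1 - (om ^+ j * w) *: a) * \sum_(k < n) (om ^+ (j * k)) *: X ^+ k.
  have -> : w ^+ n *: a ^+ n = ((om ^+ j * w) *: a) ^+ n.
    by rewrite exprZn exprMn -exprM mulnC exprM (prim_expr_order omn) expr1n mul1r.
  rewrite -{1}(expr1n U n) subrXX; congr (_ * _); apply: eq_bigr => k _.
  by rewrite expr1n mul1r -scalerA exprZn exprM.
have -> : (1 - w ^+ n *: a ^+ n) * (n%:R^-1 *: \sum_(j < n) g (om ^+ j * w)) - 1
  = n%:R^-1 *: \sum_(j < n) (((1 - (om ^+ j * w) *: a) * g (om ^+ j * w) - 1)
       * \sum_(k < n) (om ^+ (j * k)) *: X ^+ k).
  (* Orthogonality of the roots of unity: averaging over [j] leaves only the term [k = 0]. *)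
  have one : (1 : U) = n%:R^-1 *: \sum_(j < n) \sum_(k < n) om ^+ (j * k) *: X ^+ k.
    rewrite exchange_big /=; under eq_bigr do rewrite -scaler_suml.
    under eq_bigr do rewrite (sum_prim_root_expr omn (ltn_ord _)).
    rewrite (bigD1 (Ordinal n0)) //= big1 => [|k /negPf]; last first.
      by rewrite -val_eqE /= => ->; rewrite scale0r.
    by rewrite addr0 expr0 scalerA mulVf // scale1r.
  rewrite {2}one -scalerAr -scalerBr; congr (_ *: _).
  rewrite mulr_sumr -sumrB; apply: eq_bigr => j _.
  by rewrite [RHS]mulrBl [in RHS]mul1r (geo j) mulrAC.
rewrite (asnZ NP) (_ : N _ = 0) ?mulr0 //.
elim/big_ind: _ => [|x y|j _]; [exact: asn0|exact: asn_add_eq0|].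
exact: asn_mul_eq0.
Qed.

(** With d = 1/(2n), Bernoulli's inequality gives (1 + d)^n >= 3/2 and (1 - d)^n >= 1/2; the latter
    and (1 - d^2)^n <= 1 give (1 + d)^n <= 2. *)
Lemma bernoulli_bounds n : (0 < n)%N ->
  let t : R := (1 + (2 * n%:R)^-1) ^+ n in 3 / 2 <= t <= 2.
Proof.
move=> n0 /=; have nR : 0 < n%:R :> R by rewrite ltr0n.
set d : R := (2 * n%:R)^-1.
have d0 : 0 < d by rewrite invr_gt0 mulr_gt0.
have nd : n%:R * d = 1 / 2 by rewrite /d; field; rewrite gt_eqF.
have d1 : d <= 1 / 2 by rewrite -nd ler_peMl ?ler1n ?(ltW d0).
have lower (x : R) m : - 1 <= x -> 1 + m%:R * x <= (1 + x) ^+ m.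
  move=> x1; elim: m => [|m IH]; first by rewrite mul0r addr0 expr0.
  have x10 : 0 <= 1 + x by lra.
  apply: le_trans (_ : (1 + x) * (1 + m%:R * x) <= _); last first.
    by rewrite exprS ler_wpM2l.
  have mx : 0 <= m%:R * x ^+ 2 by rewrite mulr_ge0 ?sqr_ge0.
  by rewrite -natr1; nra.
apply/andP; split; first by have := lower d n; rewrite nd; lra.
have h1 : 1 / 2 <= (1 - d) ^+ n by have := lower (- d) n; rewrite mulrN nd; lra.
have h2 : (1 + d) ^+ n * (1 - d) ^+ n <= 1.
  by rewrite -exprMn exprn_ile1 //; nra.
have h3 : 0 <= (1 + d) ^+ n by rewrite exprn_ge0; lra.
by nra.
Qed.

(* The averages E, Et over the circles of radii [nrm w] and
   [(1 + 1 / 2n) nrm w] differ by O(1 / n), because those of the resolvents do;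
   on the other hand E - Et = (1 - t) x E Et with t - 1 >= 1 / 2. *)
Lemma power_resolvent_small a n w (g : R[i] -> U) C (s := 1 + (2 * n%:R)^-1) :
  (0 < n)%N ->
  (forall w', nrm w' = nrm w \/ nrm w' = s * nrm w ->
     N ((1 - w' *: a) * g w' - 1) = 0 /\ N (g w') <= C) ->
  let x := w ^+ n *: a ^+ n in
  exists E, [/\ N ((1 - x) * E - 1) = 0, N E <= C &
    N (x * E ^+ 2) <= nrm w * N a * C ^+ 2 * (2 * N 1 + C) / n%:R].
Proof.
move=> n0 gP x; have nR : 0 < n%:R :> R by rewrite ltr0n.
have [om omn] := closed_prim_root_exists R[i] n0.
have om1 j : nrm (om ^+ j) = 1.
  have omn1 : nrm om ^+ n = 1 by rewrite -nrmX (prim_expr_order omn) nrm1.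
  by move/eqP: omn1; rewrite nrmX pexprn_eq1 ?nrm_ge0 // => /predU1P[n0'|/eqP ->];
    rewrite ?expr1n //; rewrite n0' in n0.
have s0 : 0 < s by rewrite ltr_pwDl // invr_ge0 mulr_ge0 // ltW.
have g1 j : N ((1 - (om ^+ j * w) *: a) * g (om ^+ j * w) - 1) = 0 /\
   N (g (om ^+ j * w)) <= C by apply: gP; left; rewrite nrmM om1 mul1r.
have g2 j : N ((1 - (om ^+ j * (s%:C * w)) *: a) * g (om ^+ j * (s%:C * w)) - 1) = 0 /\
   N (g (om ^+ j * (s%:C * w))) <= C.
  by apply: gP; right; rewrite !nrmM om1 mul1r nrm_real gtr0_norm.
pose av w' := n%:R^-1 *: \sum_(j < n) g (om ^+ j * w').
have avE : N ((1 - x) * av w - 1) = 0.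
  by apply: resolvent_average => // j; have [] := g1 j.
have avC w' : (forall j, N (g (om ^+ j * w')) <= C) -> N (av w') <= C.
  move=> h; have := @asn_average 'I_n (fun j => g (om ^+ j * w')) C.
  by rewrite card_ord; apply.
exists (av w); split=> //; first by apply: avC => j; have [] := g1 j.
set t := (s ^+ n)%:C; set Et := av (s%:C * w); set E := av w.
have EC : N E <= C by apply: avC => j; have [] := g1 j.
have avEt : N ((1 - t *: x) * Et - 1) = 0.
  have -> : t *: x = (s%:C * w) ^+ n *: a ^+ n.
    by rewrite /t /x scalerA exprMn rmorphXn.
  by apply: resolvent_average => // j; have [] := g2 j.
have dE : N (E - Et) <= nrm w * N a * C ^+ 2 / (2 * n%:R).
  rewrite /E /Et /av -scalerBr -sumrB.
  have := @asn_average 'I_n (fun j => g (om ^+ j * w) - g (om ^+ j * (s%:C * w)))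
    (nrm w * N a * C ^+ 2 / (2 * n%:R)).
  rewrite card_ord; apply=> // j.
  have [g11 g12] := g1 j; have [g21 g22] := g2 j.
  apply: le_trans (resolvent_sub_le g12 g22 g11 g21) _.
  rewrite -mulrBr nrmM om1 mul1r -{1}[w]mul1r -mulrBl nrmM.
  have -> : 1 - s%:C = (1 - s)%:C by rewrite rmorphB.
  rewrite nrm_real /s opprD addrA subrr sub0r normrN gtr0_norm ?invr_gt0 ?mulr_gt0 //.
  by rewrite le_eqVlt; apply/orP; left; apply/eqP; ring.
have /andP[t1 t2] := bernoulli_bounds n0; rewrite -/s in t1 t2.
have xEEt : N (x * E * Et) <= nrm w * N a * C ^+ 2 / n%:R.
  have -> : nrm w * N a * C ^+ 2 / n%:R = 2 * (nrm w * N a * C ^+ 2 / (2 * n%:R)).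
    by field; rewrite gt_eqF.
  have avE1 : N ((1 - 1 *: x) * E - 1) = 0 by rewrite scale1r.
  have h := asn_congr (resolvent_sub avE1 avEt).
  rewrite h (asnZ NP) in dE.
  have h2 : nrm (1 - t) = s ^+ n - 1.
    have -> : 1 - t = (1 - s ^+ n)%:C by rewrite rmorphB.
    by rewrite nrm_real distrC ger0_norm // subr_ge0; lra.
  rewrite h2 in dE; have := asn_ge0 NP (x * E * Et).
  by nra.
(* (1 - t x) E = t + (1 - t) E because (1 - x) E = 1, up to null elements. Multiplying x E Et by
   this bounded factor replaces Et by E. *)
have txE : N ((1 - t *: x) * E) <= 2 * N 1 + C.
  have h : N ((1 - t *: x) * E - (t *: 1 + (1 - t) *: E)) = 0.
    have -> : (1 - t *: x) * E - (t *: 1 + (1 - t) *: E) = t *: ((1 - x) * E - 1).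
      by rewrite -[t *: x]mulr_algl -[(1 - t) *: E]mulr_algl -[t *: (_ - _)]mulr_algl
       scalerBl scale1r; ring.
    by rewrite (asnZ NP) avE mulr0.
  rewrite (asn_congr h); apply: le_trans (asnD NP _ _) _; rewrite (asnZ NP t) (asnZ NP (1 - t)).
  have -> : 1 - t = (1 - s ^+ n)%:C by rewrite rmorphB.
  rewrite !nrm_real ger0_norm ?exprn_ge0 ?(ltW s0) // distrC ger0_norm; last lra.
  have := asn_ge0 NP 1; have := asn_ge0 NP E => ? ?.
  by apply: lerD; nra.
have -> : N (x * E ^+ 2) = N ((x * E * Et) * ((1 - t *: x) * E)).
  apply: asn_congr.
  have -> : x * E ^+ 2 - x * E * Et * ((1 - t *: x) * E) =
     ((1 - t *: x) * Et - 1) * (- (x * E ^+ 2)).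
    by rewrite -[t *: x]mulr_algl; ring.
  exact: asn_mul_eq0.
apply: le_trans (asnM NP _ _) _; rewrite [leRHS]mulrAC.
by rewrite ler_pM ?(asn_ge0 NP).
Qed.

End Seminorm.

(** * Unitization, Neumann series and n-th roots *)

Record comm_normed_algebra (R : realType) (V : completeNormedModType R[i])
    (mul : V -> V -> V) : Prop := CommNormedAlgebra {
  cnaA : associative mul;
  cnaC : commutative mul;
  cnaDl : left_distributive mul +%R;
  cnaZl : forall (z : R[i]) a b, mul (z *: a) b = z *: mul a b;
  cna_nrm : forall a b, nrm (mul a b) <= nrm a * nrm b }.

Section Unitization.
Variables (R : realType) (V : completeNormedModType R[i]) (mul : V -> V -> V).
Hypothesis H : comm_normed_algebra mul.

Lemma cnaDr a b c : mul a (b + c) = mul a b + mul a c.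
Proof. by rewrite (cnaC H) (cnaDl H) !(cnaC H a). Qed.

Lemma cnaZr (z : R[i]) a b : mul a (z *: b) = z *: mul a b.
Proof. by rewrite (cnaC H) (cnaZl H) (cnaC H a). Qed.

(** The pair (c, x) stands for c + x. The phantom argument of type [comm_normed_algebra mul] lets
    the ring structure built from [mul] be attached to the type. *)
Definition unitization of comm_normed_algebra mul : Type := (R[i]^o * V)%type.
Local Notation U := (unitization H).
HB.instance Definition _ := GRing.Lmodule.copy U (R[i]^o * V)%type.

Definition unitz_one : U := (1, 0).
Definition unitz_mul (x y : U) : U :=
  (x.1 * y.1, x.1 *: y.2 + y.1 *: x.2 + mul x.2 y.2).

Lemma unitz_mulA : associative unitz_mul.
Proof.
move=> [a x] [b y] [c z]; rewrite /unitz_mul /=; congr (_, _); first exact: mulrA.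
rewrite !(cnaDl H) !cnaDr !(cnaZl H) !cnaZr (cnaA H) !scalerDr !scalerA.
rewrite -!addrA [c * a]mulrC [c * b]mulrC; congr (_ + _); congr (_ + _).
rewrite [LHS]addrCA; congr (_ + _); rewrite [RHS]addrCA; congr (_ + _).
by rewrite addrCA.
Qed.

Lemma unitz_mulC : commutative unitz_mul.
Proof.
move=> [a x] [b y]; rewrite /unitz_mul /=; congr (_, _); first exact: mulrC.
by rewrite (cnaC H) [a *: y + _]addrC.
Qed.

Lemma unitz_mul1 : left_id unitz_one unitz_mul.
Proof.
move=> [b y]; rewrite /unitz_mul /=; congr (_, _); first exact: mul1r.
by rewrite scale1r scaler0 addr0 -(scale0r (0 : V)) (cnaZl H) !scale0r addr0.
Qed.

Lemma unitz_mulDl : left_distributive unitz_mul +%R.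
Proof.
move=> [a x] [b y] [c z]; rewrite /unitz_mul /=; congr (_, _); first exact: mulrDl.
by rewrite (cnaDl H) scalerDl scalerDr [X in X + _]addrACA [LHS]addrACA.
Qed.

Lemma unitz_one_neq0 : unitz_one != 0.
Proof. by apply/eqP => /(congr1 fst)/eqP; rewrite oner_eq0. Qed.

HB.instance Definition _ := GRing.Zmodule_isComNzRing.Build U
  unitz_mulA unitz_mulC unitz_mul1 unitz_mulDl unitz_one_neq0.

Lemma unitz_scaleAl (a : R[i]) (x y : U) : a *: (x * y) = (a *: x) * y.
Proof.
case: x y => [b x] [c y]; congr (_, _); first exact: mulrA.
by rewrite /= (cnaZl H) !scalerDr !scalerA [c * a]mulrC.
Qed.

HB.instance Definition _ := GRing.Lmodule_isLalgebra.Build R[i] U unitz_scaleAl.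
HB.instance Definition _ := GRing.Lalgebra_isComAlgebra.Build R[i] U.

Definition uin (x : V) : U := (0, x).

Lemma uinD x y : uin (x + y) = uin x + uin y.
Proof. by congr (_, _); rewrite /= addr0. Qed.

Lemma uinN x : uin (- x) = - uin x.
Proof. by congr (_, _); rewrite /= oppr0. Qed.

Lemma uinB x y : uin (x - y) = uin x - uin y.
Proof. by rewrite uinD uinN. Qed.

Lemma uinZ (z : R[i]) x : uin (z *: x) = z *: uin x.
Proof. by congr (_, _); rewrite /= scaler0. Qed.

Lemma uinZA (z : R[i]) x : uin (z *: x) = z%:A * uin x.
Proof. by rewrite uinZ mulr_algl. Qed.

Lemma uinM x y : uin (mul x y) = uin x * uin y.
Proof.
by congr (_, _); rewrite /= ?mulr0 // !scale0r !add0r.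
Qed.

Lemma uin_inj : injective uin.
Proof. by move=> x y []. Qed.

Lemma unitzE (x : U) : x = x.1 *: 1 + uin x.2.
Proof.
case: x => c x; congr (_, _) => /=; first by rewrite addr0 /GRing.scale /= mulr1.
by rewrite scaler0 add0r.
Qed.

Lemma uin_mul x (y : U) : uin x * y = uin (y.1 *: x + mul x y.2).
Proof. by rewrite uinD uinZ uinM [y in LHS]unitzE mulrDr -scalerAr mulr1. Qed.

Lemma unitz_fstM (x y : U) : (x * y).1 = x.1 * y.1. Proof. by []. Qed.

Lemma uin_apow a n : uin (apow mul a n) = uin a ^+ n.+1.
Proof. by elim: n => [|n IH]; rewrite ?expr1 // exprS -IH -uinM. Qed.

Definition unitz_nrm (x : U) : R := nrm (x.1 : R[i]) + nrm x.2.

Lemma unitz_nrm_asn : alg_seminorm unitz_nrm.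
Proof.
split=> [x|x y|z x|x y]; rewrite /unitz_nrm.
- by rewrite addr_ge0 ?nrm_ge0.
- by rewrite addrACA lerD // nrmD.
- by rewrite mulrDr -nrmZ -nrmM.
have h1 := nrmD (x.1 *: y.2 + y.1 *: x.2) (mul x.2 y.2).
have h2 := nrmD (x.1 *: y.2) (y.1 *: x.2).
have h3 := cna_nrm H x.2 y.2.
rewrite /= nrmM; rewrite !nrmZ in h2.
nra.
Qed.

Lemma unitz_nrm_uin x : unitz_nrm (uin x) = nrm x.
Proof. by rewrite /unitz_nrm /= nrm0 add0r. Qed.

Lemma unitz_nrm1 : unitz_nrm 1 = 1.
Proof. by rewrite /unitz_nrm /= nrm0 addr0 nrm1. Qed.

(** [s] is the fixed point of s = y + y s, found by contraction instead of summing the powers of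
    [y]. *)
Lemma neumann y : nrm y < 1 -> exists s, (1 - uin y) * (1 + uin s) = 1.
Proof.
move=> y1.
have [|//|//|//|x z _ _|s [_ sE]] :=
  @contraction_fixpoint _ V (fun=> True) (fun s => y + mul y s) (nrm y).
- by rewrite nrm_ge0.
- have -> : y + mul y x - (y + mul y z) = mul y (x - z).
    by apply: uin_inj; rewrite !(uinD, uinN, uinM); ring.
  exact: cna_nrm.
exists s; rewrite mulrDr mulr1 mulrBl mul1r -uinM -{1}sE uinD; ring.
Qed.

(** By z t - 1 = (z - 1) t + (t - 1), each new factor multiplies the bound on one plus the distance
    to 1 by 1 + rho. *)
Lemma unitz_nrm_near1 (rho : R) (x y : U) i j :
  unitz_nrm (x - 1) <= rho -> unitz_nrm (y - 1) <= rho ->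
  unitz_nrm (x ^+ i * y ^+ j - 1) <= (1 + rho) ^+ (i + j) - 1.
Proof.
have NP := unitz_nrm_asn.
have step (z t : U) m : unitz_nrm (z - 1) <= rho ->
    unitz_nrm (t - 1) <= (1 + rho) ^+ m - 1 ->
    unitz_nrm (z * t - 1) <= (1 + rho) ^+ m.+1 - 1.
  move=> zr tm; have -> : z * t - 1 = (z - 1) * t + (t - 1) by ring.
  apply: le_trans (asnD NP _ _) _.
  have h1 := asnM NP (z - 1) t.
  have h2 : unitz_nrm t <= unitz_nrm (t - 1) + 1.
    by rewrite -unitz_nrm1 -{1}(subrK 1 t) (asnD NP).
  have h3 := asn_ge0 NP (z - 1); have h4 := asn_ge0 NP t.
  rewrite exprS; nra.
move=> xr yr; elim: i => [|i IH]; last by rewrite exprS -mulrA; exact: step.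
rewrite expr0 mul1r; elim: j => [|j IH]; last by rewrite exprS; exact: step.
by rewrite !expr0 !subrr (asn0 NP).
Qed.

(* (1 + r)^n = 1 + y has a solution of size 1 / 4n: the map
   r |-> (y - ((1 + r)^n - 1 - n r)) / n is a contraction. *)
Lemma nth_root_near_one (P : V -> Prop) n y : (0 < n)%N -> nrm y <= 1 / 8 ->
  P 0 -> (forall x z, P x -> P z -> P (x + z)) ->
  (forall (c : R[i]) x, P x -> P (c *: x)) -> (forall x z, P x -> P (mul x z)) ->
  (forall x, (forall eps, 0 < eps -> exists y, P y /\ nrm (x - y) < eps) -> P x) ->
  P y ->
  exists r, [/\ P r, nrm r <= (4 * n%:R)^-1 & (1 + uin r) ^+ n = 1 + uin y].
Proof.
move=> n0 y8 P_0 P_D P_Z P_M Pcl Py.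
have nR : 0 < n%:R :> R by rewrite ltr0n.
have nC : n%:R != 0 :> R[i] by rewrite pnatr_eq0 -lt0n.
pose rho : R := (4 * n%:R)^-1.
have rho0 : 0 < rho by rewrite invr_gt0 mulr_gt0.
have asnP := unitz_nrm_asn.
have powE (r : V) m : exists t, (1 + uin r) ^+ m = 1 + uin t /\ (P r -> P t).
  elim: m => [|m [t [IH Pt]]].
    by exists 0; rewrite expr0; split=> //; rewrite (_ : uin 0 = 0) ?addr0.
  exists (r + t + mul r t); split.
    by rewrite exprS IH !uinD uinM; ring.
  by move=> Pr; apply: (P_D); [apply: (P_D) => //; exact: Pt|exact: P_M].
(* The [V]-component of (1 + r)^n is (1 + r)^n - 1. *)
pose f r := n%:R^-1 *: (y - (((1 + uin r) ^+ n).2 - n%:R *: r)).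
have fE r : n%:R *: uin (f r) = uin y - ((1 + uin r) ^+ n - 1 - n%:R *: uin r).
  rewrite -uinZ /f scalerA divff // scale1r !uinB uinZ; congr (_ - (_ - _)).
  have [t [-> _]] := powE r n.
  by rewrite addrAC subrr add0r /= add0r.
(* [bernoulli_bounds] for 2n bounds the square of (1 + rho)^n by 2, so (1 + rho)^n <= 3/2. *)
have rho_pow : (1 + rho) ^+ n.-1 - 1 <= 1 / 2.
  have n20 : (0 < n * 2)%N by rewrite muln_gt0 n0.
  have /= /andP[_] := bernoulli_bounds R n20.
  have -> : (2 * (n * 2)%:R)^-1 = rho :> R by congr (_^-1); rewrite natrM; ring.
  rewrite exprM => b2.
  have le1 : (1 + rho) ^+ n.-1 <= (1 + rho) ^+ n.
    by rewrite ler_weXn2l ?leq_pred // lerDl ltW.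
  have : 0 <= (1 + rho) ^+ n by rewrite exprn_ge0 // addr_ge0 // ltW.
  nra.
have flip x z : nrm x <= rho -> nrm z <= rho ->
    nrm (f x - f z) <= 1 / 2 * nrm (x - z).
  move=> xr zr; rewrite -(ler_pM2l nR) -[in leLHS](nrm_nat R n) -nrmZ.
  rewrite scalerBr -(unitz_nrm_uin (n%:R *: _ - _)) uinB (uinZ _ (f x)) (uinZ _ (f z)) !fE.
  (* x - z factors out of (1 + x)^n - (1 + z)^n, and each of the n terms of the cofactor differs
     from 1 by at most 1/2; hence the contraction ratio 1/2. *)
  have -> : uin y - ((1 + uin x) ^+ n - 1 - n%:R *: uin x) -
      (uin y - ((1 + uin z) ^+ n - 1 - n%:R *: uin z)) =
      - (uin (x - z) * \sum_(i < n) ((1 + uin x) ^+ (n.-1 - i) * (1 + uin z) ^+ i - 1)).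
    rewrite sumrB sumr_const card_ord mulrBr.
    have -> : uin (x - z) = (1 + uin x) - (1 + uin z) by rewrite uinB; ring.
    by rewrite -subrXX -(mulr_algl _ (uin x)) -(mulr_algl _ (uin z)) scaler_nat; ring.
  rewrite (asnN asnP); apply: le_trans (asnM asnP _ _) _.
  rewrite unitz_nrm_uin mulrA [leLHS]mulrC ler_wpM2r ?nrm_ge0 //.
  apply: le_trans (asn_sum asnP _) _.
  have hle (i : 'I_n) : unitz_nrm ((1 + uin x) ^+ (n.-1 - i) * (1 + uin z) ^+ i - 1)
      <= 1 / 2.
    apply: le_trans rho_pow; rewrite -{2}(@subnK i n.-1); last first.
      by rewrite -ltnS prednK.
    by apply: unitz_nrm_near1; rewrite addrAC subrr add0r unitz_nrm_uin.
  apply: le_trans (ler_sum _ (fun i _ => hle i)) _.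
  by rewrite sumr_const card_ord mulr_natl.
have f0 : f 0 = n%:R^-1 *: y.
  rewrite /f (_ : uin 0 = 0) // addr0 expr1n scaler0 subr0 /=.
  by rewrite subr0.
have [|||x xcl|x z [_ xr] [_ zr]|r [[Pr rr] fr]] := @contraction_fixpoint _ V
    (fun r => P r /\ nrm r <= rho) f (1 / 2).
- by apply/andP; split; lra.
- by rewrite nrm0 ltW.
- move=> x [Px xr]; split.
    have [t [tE Pt]] := powE x n.
    rewrite /f tE /= add0r; apply: (P_Z); apply: (P_D) => //.
    by rewrite opprB; apply: (P_D); [exact: P_Z|rewrite -scaleN1r; apply: (P_Z); exact: Pt].
  rewrite -(subrK (f 0) (f x)); apply: le_trans (nrmD _ _) _.
  have := flip x 0 xr; rewrite nrm0 subr0 => /(_ (ltW rho0)) h.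
  (* The bound 1/8 on [y] makes |f 0| <= rho / 2, so the contraction by 1/2 keeps the ball of radius
     [rho] invariant. *)
  have : nrm (f 0) <= rho / 2.
    rewrite f0 nrmZ nrmV nrm_nat.
    have -> : rho / 2 = n%:R^-1 * (1 / 8) by rewrite /rho; field; rewrite gt_eqF.
    by rewrite ler_wpM2l // invr_ge0 ltW.
  lra.
- split; first by apply: Pcl => eps /xcl [z [[Pz _] xz]]; exists z.
  rewrite leNgt; apply/negP => rx.
  rewrite -subr_gt0 in rx; have [z [[_ zr] xz]] := xcl _ rx.
  have := nrmD (x - z) z; rewrite subrK; lra.
- exact: flip.
exists r; split=> //.
have := fE r; rewrite fr; set A := n%:R *: uin r => h.
apply: subr0_eq; transitivity (A - (uin y - ((1 + uin r) ^+ n - 1 - A))); first ring.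
by rewrite -h subrr.
Qed.

End Unitization.

(** * Distance to an ideal *)

Section ResolventBounded.
Variables (R : realType) (U : comAlgType R[i]) (N : U -> R).
Hypothesis NP : alg_seminorm N.

(** By the resolvent identity, N (g w') <= 2 N (g w) for w' near w, whatever choice of inverses [g]
    makes; compactness of the disk then gives a uniform bound. [S] is closed, and off [S] the
    function is replaced by 0. *)
Lemma resolvent_bounded (S : pred R[i]) a (g : R[i] -> U) r :
  (forall w, ~~ S w -> exists d, 0 < d /\ forall w', nrm (w' - w) < d -> ~~ S w') ->
  (forall w, S w -> N ((1 - w *: a) * g w - 1) = 0) ->
  exists C, 0 <= C /\ forall w, nrm w <= r -> S w -> N (g w) <= C.
Proof.
move=> Sopen gP.
pose f w := if S w then N (g w) else 0.
have [w|M fM] := @locally_bounded_disk R f _ r.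
  case: (boolP (S w)) => Sw; last first.
    have [d [d0 Sd]] := Sopen w Sw; exists d; split=> //; exists 0 => w' /Sd.
    by rewrite /f => /negPf ->.
  have a0 := asn_ge0 NP a; have gw0 := asn_ge0 NP (g w).
  have K0 : 0 < 2 * (N a * N (g w)) + 1.
    by rewrite ltr_wpDl // mulr_ge0 // mulr_ge0.
  exists (2 * (N a * N (g w)) + 1)^-1; split; first by rewrite invr_gt0.
  exists (2 * N (g w)) => w' ww'; rewrite /f; case: ifP => [Sw'|_]; last by rewrite mulr_ge0.
  have e := asn_congr NP (resolvent_sub NP (gP _ Sw) (gP _ Sw')).
  have h1 : N (g w') <= N (g w) + N (g w - g w').
    by rewrite -{1}(subrK (g w) (g w')) addrC (asn_distC NP (g w)) (asnD NP).
  rewrite e (asnZ NP) nrm_distC in h1.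
  have h2 : N (a * g w * g w') <= N a * N (g w) * N (g w').
    apply: le_trans (asnM NP _ _) _; rewrite ler_wpM2r ?(asn_ge0 NP) //.
    exact: asnM.
  have gw'0 := asn_ge0 NP (g w'); have n0 := nrm_ge0 (w' - w).
  have h3 : nrm (w' - w) * (2 * (N a * N (g w)) + 1) <= 1.
    by rewrite -ler_pdivlMr // div1r ltW.
  set q := N a * N (g w) in h2 h3 K0.
  have q0 : 0 <= q by rewrite mulr_ge0.
  have h4 : nrm (w' - w) * N (a * g w * g w') <= nrm (w' - w) * (q * N (g w')).
    by rewrite ler_wpM2l.
  have h5 : nrm (w' - w) * q <= 1 / 2 by nra.
  by nra.
exists (Num.max M 0); split; first by rewrite le_max lexx orbT.
move=> w wr Sw; have := fM w wr; rewrite /f Sw => h.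
by rewrite le_max h.
Qed.

End ResolventBounded.

(** * Closedness of lines *)

Section LineClosed.
Variables (R : realType) (V : lmodType R[i]) (N : V -> R).
Hypothesis N_ge0 : forall x, 0 <= N x.
Hypothesis ND : forall x y, N (x + y) <= N x + N y.
Hypothesis NZ : forall (z : R[i]) x, N (z *: x) = nrm z * N x.

(** If no z reached 0, 1 / N (x - z v) would be locally bounded, hence bounded on the disk of radius
    (N x + 1) / N v. That disk contains every z with N (x - z v) < 1, against the approximations. *)
Lemma line_closed v x : 0 < N v ->
  (forall eps, 0 < eps -> exists z : R[i], N (x - z *: v) < eps) ->
  exists z : R[i], N (x - z *: v) = 0.
Proof.
move=> v0 xv; apply: contrapT => /forallNP nz.
have NN y : N (- y) = N y by rewrite -scaleN1r NZ nrmN nrm1 mul1r.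
have pos z : 0 < N (x - z *: v).
  by rewrite lt_def N_ge0 andbT; apply/eqP; exact: nz.
have [w|M fM] := @locally_bounded_disk R (fun z => (N (x - z *: v))^-1) _ ((N x + 1) / N v).
  pose d := N (x - w *: v) / 2; have d0 : 0 < d by rewrite divr_gt0.
  exists (d / N v); split; first by rewrite divr_gt0.
  exists d^-1 => w'; rewrite ltr_pdivlMr // -NZ scalerBl => ww'.
  rewrite lef_pV2 ?posrE //.
  have := ND (x - w' *: v) (w' *: v - w *: v); rewrite subrKA.
  have : d + d = N (x - w *: v) by rewrite -splitr.
  lra.
have M0 : 0 < M.
  apply: lt_le_trans (fM 0 _); first by rewrite invr_gt0.
  by rewrite nrm0 divr_ge0 ?N_ge0 // addr_ge0.
have e0 : 0 < Num.min 1 M^-1 by rewrite lt_min ltr01 invr_gt0.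
have [z] := xv _ e0; rewrite lt_min => /andP[z1 zM].
have zr : nrm z <= (N x + 1) / N v.
  rewrite ler_pdivlMr // -NZ.
  have := ND (- (x - z *: v)) x; rewrite NN opprB subrK; lra.
have := fM z zr; rewrite leNgt => /negP; apply.
by rewrite -[M]invrK ltf_pV2 ?posrE ?invr_gt0.
Qed.

End LineClosed.

(** * Ideals and the quotient norm *)

Section Ideals.
Variables (R : realType) (V : completeNormedModType R[i]) (mul : V -> V -> V).
Hypothesis H : comm_normed_algebra mul.
Local Notation U := (unitization H).
Local Notation uin := (@uin R V mul H).

Record is_ideal (J : V -> Prop) : Prop := IsIdeal {
  ideal0 : J 0;
  idealD : forall x y, J x -> J y -> J (x + y);
  idealZ : forall (z : R[i]) x, J x -> J (z *: x);
  idealM : forall x y, J x -> J (mul x y) }.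

(** The quotient seminorm of V / J; for an ideal [J] it vanishes exactly on the closure of [J]. *)
Definition dist (J : V -> Prop) (x : V) : R :=
  inf [set r | exists j, J j /\ r = nrm (x - j)].

Section Dist.
Variable J : V -> Prop.
Hypothesis JI : is_ideal J.

Lemma idealN x : J x -> J (- x).
Proof. by rewrite -scaleN1r; exact: (idealZ JI). Qed.

Lemma idealB x y : J x -> J y -> J (x - y).
Proof. by move=> Jx Jy; apply: (idealD JI) => //; exact: idealN. Qed.

Lemma dist_le x j : J j -> dist J x <= nrm (x - j).
Proof.
move=> Jj; apply: ge_inf; last by exists j.
by exists 0 => _ [k [_ ->]]; exact: nrm_ge0.
Qed.

Lemma dist_le_nrm x : dist J x <= nrm x.
Proof. by rewrite -{2}[x]subr0; apply: dist_le; exact: ideal0. Qed.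

Lemma dist_ge0 x : 0 <= dist J x.
Proof.
apply: lb_le_inf; first by exists (nrm (x - 0)); exists 0; split=> //; exact: ideal0.
by move=> _ [k [_ ->]]; exact: nrm_ge0.
Qed.

Lemma dist_lt x r : dist J x < r -> exists j, J j /\ nrm (x - j) < r.
Proof.
move=> /inf_lt[|_ [j [Jj ->]] jr]; last by exists j.
by exists (nrm (x - 0)), 0; split=> //; exact: ideal0.
Qed.

Lemma dist_near x eps : 0 < eps -> exists j, J j /\ nrm (x - j) < dist J x + eps.
Proof. by move=> e0; apply: dist_lt; rewrite ltrDl. Qed.

Lemma dist_approx x y (m : R) : (forall eps, 0 < eps -> dist J x <= y + eps * m) ->
  0 < m -> dist J x <= y.
Proof.
move=> h m0; rewrite leNgt; apply/negP => yx.
have := h ((dist J x - y) / 2 / m) _; rewrite divfK ?gt_eqF // !divr_gt0 ?subr_gt0 //.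
by move=> /(_ isT); lra.
Qed.

Lemma distD x y : dist J (x + y) <= dist J x + dist J y.
Proof.
apply: (@dist_approx _ _ 2) => // eps e0.
have [j [Jj xj]] := dist_near x e0.
have [k [Jk yk]] := dist_near y e0.
have := dist_le (x + y) (idealD JI Jj Jk).
have -> : x + y - (j + k) = (x - j) + (y - k) by rewrite opprD addrACA.
by have := nrmD (x - j) (y - k); lra.
Qed.

Lemma dist_eq0 x : J x -> dist J x = 0.
Proof.
move=> Jx; apply/eqP; rewrite eq_le dist_ge0 andbT.
by have := dist_le x Jx; rewrite subrr nrm0.
Qed.

Lemma distZ (z : R[i]) x : dist J (z *: x) = nrm z * dist J x.
Proof.
have le w y : dist J (w *: y) <= nrm w * dist J y.
  apply: (@dist_approx _ _ (nrm w + 1)); last by rewrite ltr_wpDl // nrm_ge0.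
  move=> eps e0; have [j [Jj xj]] := dist_near y e0.
  have := dist_le (w *: y) (idealZ JI w Jj); rewrite -scalerBr nrmZ.
  have := nrm_ge0 w; nra.
have [->|z0] := eqVneq z 0.
  by rewrite scale0r nrm0 mul0r dist_eq0 //; exact: ideal0.
apply/eqP; rewrite eq_le le /=.
have nz : 0 < nrm z by rewrite nrm_gt0.
have := le z^-1 (z *: x); rewrite scalerA mulVf // scale1r nrmV.
by rewrite mulrC ler_pdivlMr // mulrC.
Qed.

Lemma distM x y : dist J (mul x y) <= dist J x * dist J y.
Proof.
have m0 : 0 < dist J x + dist J y + 1 by rewrite ltr_wpDl // addr_ge0 // dist_ge0.
apply: dist_approx m0 => eps e0.
pose e := Num.min eps 1.
have e'0 : 0 < e by rewrite lt_min e0 ltr01.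
have [e1 e2] : e <= eps /\ e <= 1 by split; rewrite ge_min lexx ?orbT.
have [j [Jj xj]] := dist_near x e'0.
have [k [Jk yk]] := dist_near y e'0.
(* Subtracting this element of [J] from x y leaves (x - j)(y - k). *)
have JJ : J (mul j (y - k) + mul k x).
  by apply: (idealD JI); apply: (idealM JI).
have := dist_le (mul x y) JJ.
have -> : mul x y - (mul j (y - k) + mul k x) = mul (x - j) (y - k).
  by apply: (@uin_inj _ _ _ H); rewrite !(uinD, uinN, uinM); ring.
have := cna_nrm H (x - j) (y - k).
have := nrm_ge0 (x - j); have := nrm_ge0 (y - k).
have := dist_ge0 x; have := dist_ge0 y.
set X := nrm (x - j) in xj *; set Y := nrm (y - k) in yk *.
set a := dist J x in xj *; set b := dist J y in yk * => b0 a0 Y0 X0 h1 h2.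
have h3 : X * Y <= (a + e) * (b + e) by rewrite ler_pM // ltW.
have h4 : (a + e) * (b + e) <= a * b + e * (a + b + 1) by nra.
have h5 : e * (a + b + 1) <= eps * (a + b + 1) by rewrite ler_wpM2r // ltW // ltr_wpDl // addr_ge0.
lra.
Qed.

Variable u : V.
Hypothesis Ju : forall x, J (x - mul x u).

Lemma modular_full : J u -> forall x, J x.
Proof.
move=> J_u x; rewrite -(subrK (mul x u) x) (cnaC H x); apply: (idealD JI) => //.
  by rewrite (cnaC H u).
exact: (idealM JI).
Qed.

(** If |u - j| < 1 with j in J, then 1 - (u - j) is invertible in the unitization, while u (1 - (u -
    j)) = (u - u u) + j u lies in J; so u is in J. *)
Lemma proper_modular_dist : ~ J u -> 1 <= dist J u.
Proof.
move=> nJ; rewrite leNgt; apply/negP => /dist_lt[j [Jj uj]]; apply: nJ.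
have [s /(congr1 (fun x => uin u * x))] := neumann H uj.
rewrite mulr1 mulrA.
have -> : uin u * (1 - uin (u - j)) = uin (u - mul u u + mul j u).
  by rewrite !(uinD, uinN, uinM); ring.
rewrite uin_mul => /uin_inj <-; apply: (idealD JI).
  by apply: (idealZ JI); apply: (idealD JI) => //; exact: (idealM JI).
by apply: (idealM JI); apply: (idealD JI) => //; exact: (idealM JI).
Qed.

(* The quotient norm of A / J, whose unit is the class of u, pulled back to the
   unitization. *)
Definition quot_nrm (x : U) : R := dist J (x.2 + x.1 *: u).

Lemma quot_nrm_asn : alg_seminorm quot_nrm.
Proof.
split=> [x|x y|z x|x y]; rewrite /quot_nrm.
- exact: dist_ge0.
- by rewrite /= scalerDl addrACA distD.
- by rewrite /= -scalerA -scalerDr distZ.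
apply: le_trans (distM _ _).
set p := mul _ _; set q := _ + _.
suff Jqp : J (q - p).
  by rewrite -(subrK p q); apply: le_trans (distD _ _) _; rewrite (dist_eq0 Jqp) add0r.
have -> : q - p = x.1 *: (y.2 - mul y.2 u) + y.1 *: (x.2 - mul x.2 u)
   + (x.1 * y.1) *: (u - mul u u).
  apply: (@uin_inj _ _ _ H); rewrite /p /q /=.
  have algM (z w : R[i]) : (z * w)%:A = z%:A * w%:A :> U.
    by rewrite mulr_algl scalerA.
  by rewrite !(uinD, uinN, uinM, uinZA, algM); ring.
by apply: (idealD JI); [apply: (idealD JI)|]; apply: (idealZ JI).
Qed.

End Dist.
End Ideals.

(** * Late density and the spectrum modulo an ideal *)

Section LateDense.
Variables (R : realType) (V : completeNormedModType R[i]) (mul : V -> V -> V).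

Definition late_dense (b : V) : Prop := forall x eps n0, 0 < eps ->
  exists (z : R[i]) n, (n0 <= n)%N /\ nrm (x - z *: apow mul b n) < eps.

Lemma supercyclic_approx : supercyclic mul -> exists a : V, forall x eps, 0 < eps ->
  exists (z : R[i]) n, nrm (x - z *: apow mul a n) < eps.
Proof.
case=> a ad; exists a => x eps e0.
have e0C : 0 < eps%:C :> R[i] by rewrite ltcR.
have ne : ball x eps%:C !=set0 by exists x; exact: ballxx.
have [y [xb [z [n [n0 yE]]]]] := ad _ ne (ball_open x _).
by exists z, n.-1; move: xb; rewrite yE -ball_normE /ball_ /= nrmE ltcR.
Qed.

Lemma not_line : dim_gt1 V -> forall v : V, exists y, forall z : R[i], y <> z *: v.
Proof.
case=> w wi v; apply: contrapT => /forallNP nl.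
have span y : exists z : R[i], y = z *: v by apply: contrapT => /forallNP; exact: nl.
have [z0 e0] := span (w ord0); have [z1 e1] := span (w (lift ord0 ord0)).
have comb (c0 c1 : R[i]) : c0 *: w ord0 + c1 *: w (lift ord0 ord0) = 0 ->
    c0 = 0 /\ c1 = 0.
  pose c (i : 'I_2) := if i == ord0 then c0 else c1.
  have := wi c; rewrite big_ord_recl big_ord1 /= => h /h h0.
  by split; [exact: (h0 ord0)|exact: (h0 (lift ord0 ord0))].
have [z00|z00] := eqVneq z0 0.
  have [|/eqP] := comb 1 0; last by rewrite oner_eq0.
  by rewrite e0 z00 scale0r scaler0 scale0r addr0.
have [|_ /eqP] := comb z1 (- z0); last by rewrite oppr_eq0 (negPf z00).
by rewrite e0 e1 scaleNr !scalerA mulrC subrr.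
Qed.

(** A line is closed, so it suffices to be off it; if [x] is on the line, a small multiple of a
    vector outside is added. *)
Lemma off_line (v x : V) eps : dim_gt1 V -> 0 < eps ->
  exists x', nrm (x - x') < eps /\ exists d, 0 < d /\
    forall z : R[i], d <= nrm (x' - z *: v).
Proof.
move=> dimV e0.
have [x' [xx' x'v]] : exists x', nrm (x - x') < eps /\ forall z : R[i], x' <> z *: v.
  have [[z xz]|/forallNP xv] := pselect (exists z : R[i], x = z *: v); last first.
    by exists x; rewrite subrr nrm0.
  have [y yv] := not_line dimV v.
  have y1 : 0 < nrm y + 1 by rewrite ltr_wpDl // nrm_ge0.
  pose t : R[i] := (eps / (nrm y + 1))%:C.
  have t0 : 0 < eps / (nrm y + 1) by rewrite divr_gt0.
  exists (x + t *: y); split.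
    rewrite opprD addrA subrr sub0r nrmN nrmZ nrm_real gtr0_norm //.
    by rewrite mulrAC ltr_pdivrMr // ltr_pM2l // ltrDl.
  move=> z'; rewrite xz => /(canRL (addKr _)).
  rewrite addrC -scalerBl => /(congr1 (fun s => t^-1 *: s)).
  have tn0 : t != 0 by rewrite -nrm_gt0 nrm_real normr_gt0 gt_eqF.
  by rewrite scalerA mulVf // scale1r scalerA; exact: yv.
exists x'; split=> //.
have [v0|v0] := eqVneq v 0.
  exists (nrm x'); split; last by move=> z; rewrite v0 scaler0 subr0.
  by rewrite nrm_gt0; apply/eqP => x'0; apply: (x'v 0); rewrite scale0r.
apply: contrapT => /forallNP nd.
have [||z] := @line_closed R V (@nrm R V) (@nrm_ge0 R V) (@nrmD R V) (@nrmZ R V) v x'.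
- by rewrite nrm_gt0.
- move=> d d0; apply: contrapT => /forallNP nz; apply: (nd d); split=> // z.
  by rewrite leNgt; apply/negP; exact: nz.
by move/nrm0_eq0/subr0_eq; exact: x'v.
Qed.

(** Induction on the least exponent: after [x] is moved off the line of [apow mul a n0],
    approximants closer than its distance [d] to that line cannot use the exponent [n0]. *)
Lemma approx_late_dense a : dim_gt1 V ->
  (forall x eps, 0 < eps -> exists (z : R[i]) n, nrm (x - z *: apow mul a n) < eps) ->
  late_dense a.
Proof.
move=> dimV ad x eps n0; elim: n0 x eps => [|n0 IH] x eps e0.
  by have [z [n zn]] := ad x eps e0; exists z, n.
have e2 : 0 < eps / 2 by rewrite divr_gt0.
have [x' [xx' [d [d0 dz]]]] := off_line (apow mul a n0) x dimV e2.
have m0 : 0 < Num.min d (eps / 2) by rewrite lt_min d0.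
have [z [n [n0n]]] := IH x' _ m0; rewrite lt_min => /andP[h1 h2].
exists z, n; split; last first.
  have -> : x - z *: apow mul a n = (x - x') + (x' - z *: apow mul a n) by rewrite subrKA.
  by apply: le_lt_trans (nrmD _ _) _; rewrite [eps]splitr ltrD.
rewrite ltn_neqAle n0n andbT; apply/eqP => nn.
by move: h1; rewrite -nn ltNge dz.
Qed.

Hypothesis mulZl : forall (z : R[i]) a b, mul (z *: a) b = z *: mul a b.
Hypothesis mulZr : forall (z : R[i]) a b, mul a (z *: b) = z *: mul a b.

Lemma apowZ (w : R[i]) a n : apow mul (w *: a) n = w ^+ n.+1 *: apow mul a n.
Proof.
elim: n => [|n IH]; first by rewrite expr1.
by rewrite /= IH mulZl mulZr scalerA -exprS.
Qed.

Lemma late_denseZ (w : R[i]) a : w != 0 -> late_dense a -> late_dense (w *: a).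
Proof.
move=> w0 ad x eps n0 e0; have [z [n [nn zn]]] := ad x eps n0 e0.
exists (z / w ^+ n.+1), n; split=> //.
by rewrite apowZ scalerA divfK // expf_neq0.
Qed.

End LateDense.

(** * Spectrum modulo an ideal *)

Section Spectrum.
Variables (R : realType) (V : completeNormedModType R[i]) (mul : V -> V -> V).
Hypothesis H : comm_normed_algebra mul.
Local Notation U := (unitization H).
Local Notation uin := (@uin R V mul H).

(** The ideal J + (1 - w a) A. It contains a modular unit of J exactly when 1 - w a is invertible
    modulo J. *)
Definition ideal_add_resolvent (J : V -> Prop) (w : R[i]) (a x : V) : Prop :=
  exists v j, J j /\ x = v - w *: mul a v + j.

Lemma ideal_add_resolventP J w a :
  is_ideal mul J -> is_ideal mul (ideal_add_resolvent J w a).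
Proof.
move=> JI; split=> [|_ _ [v [j [Jj ->]]] [v' [j' [Jj' ->]]]|z _ [v [j [Jj ->]]]|_ y [v [j [Jj ->]]]].
- exists 0, 0; split; first exact: (ideal0 JI).
  by rewrite -(scale0r (0 : V)) (cnaZr H) !scale0r scaler0 subrr addr0.
- exists (v + v'), (j + j'); split; first exact: (idealD JI).
  rewrite (cnaDr H) scalerDr opprD [LHS]addrACA; congr (_ + _).
  exact: addrACA.
- exists (z *: v), (z *: j); split; first exact: (idealZ JI).
  by rewrite (cnaZr H) scalerDr scalerBr !scalerA mulrC.
- exists (mul v y), (mul j y); split; first exact: (idealM JI).
  by apply: (@uin_inj _ _ _ H); rewrite !(uinD, uinN, uinM, uinZA); ring.
Qed.

Lemma resolvent_sub_ideal J w a x : is_ideal mul J ->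
  ideal_add_resolvent J w a (x - w *: mul a x).
Proof. by move=> JI; exists x, 0; rewrite addr0; split=> //; exact: (ideal0 JI). Qed.

(* If every 1 - w a were invertible modulo J, then x = z a^n close to u would
   satisfy N(x (1 - x)^-2) = O(1/n), although x is close to the unit. *)
Lemma modular_spectrum J u a : is_ideal mul J -> (forall x, J (x - mul x u)) ->
  ~ J u -> late_dense mul a -> exists w, ~ ideal_add_resolvent J w a u.
Proof.
move=> JI Ju nJu ad; apply: contrapT => /forallNP all.
have {}all w : exists v j, J j /\ u = v - w *: mul a v + j.
  by apply: contrapT => h; exact: (all w).
have NP := quot_nrm_asn H JI Ju; set N := quot_nrm _ _ in NP.
have [v vP] := choice all.
pose g w := uin (v w).
have gP w : N ((1 - w *: uin a) * g w - 1) = 0.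
  have [j [Jj uj]] := vP w.
  have -> : (1 - w *: uin a) * g w - 1 = uin (v w - w *: mul a (v w)) - 1.
    by rewrite uinB uinZ uinM mulrBl mul1r scalerAl.
  rewrite /N /quot_nrm /= sub0r scaleN1r subr0.
  have -> : v w - w *: mul a (v w) - u = - j by rewrite {1}uj opprD addrA subrr sub0r.
  exact: (dist_eq0 JI (idealN JI Jj)).
have N1 : 1 <= N 1.
  by rewrite /N /quot_nrm /= add0r scale1r; exact: (proper_modular_dist H JI Ju nJu).
pose pw n := uin a ^+ n.+1.
have near n0 : exists z n, (n0 <= n)%N /\ N (1 - z *: pw n) < 1 / 2.
  have [|z [n [nn zn]]] := ad u (1 / 2) n0; first by rewrite divr_gt0.
  exists z, n; split=> //; rewrite /pw -uin_apow -uinZ /N /quot_nrm /= subr0 scale1r.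
  by rewrite sub0r addrC; apply: le_lt_trans zn; exact: (dist_le_nrm JI).
have [z0 [m0 [_ zm]]] := near 0%N.
pose B := 2 * nrm z0 * N (uin a) ^+ m0.
have NX y n : N (y ^+ n.+1) <= N y ^+ n.+1.
  elim: n => [|n IH]; first by rewrite !expr1.
  by rewrite exprS [leRHS]exprS; apply: le_trans (asnM NP _ _) _; rewrite ler_wpM2l ?(asn_ge0 NP).
have B0 : 0 <= B by rewrite !mulr_ge0 ?nrm_ge0 ?exprn_ge0 ?(asn_ge0 NP).
(* Since z0 a^(m0 + 1) is within 1/2 of the unit, multiplication by [a] is bounded below, with [B]
   in the role of the norm of its inverse. *)
have lowB y : N y <= B * N (uin a * y).
  have h1 : N y <= N ((1 - z0 *: pw m0) * y) + N (z0 *: (pw m0 * y)).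
    have {1}-> : y = (1 - z0 *: pw m0) * y + z0 *: (pw m0 * y).
      by rewrite scalerAl -mulrDl subrK mul1r.
    exact: (asnD NP).
  have h2 := asnM NP (1 - z0 *: pw m0) y.
  have h3 : N (pw m0 * y) <= N (uin a) ^+ m0 * N (uin a * y).
    rewrite /pw; case: (m0) => [|m]; first by rewrite expr1 expr0 mul1r.
    rewrite exprSr -mulrA; apply: le_trans (asnM NP _ _) _.
    by rewrite ler_wpM2r ?(asn_ge0 NP).
  rewrite (asnZ NP) in h1.
  have h4 : nrm z0 * N (pw m0 * y) <= nrm z0 * (N (uin a) ^+ m0 * N (uin a * y)).
    by rewrite ler_wpM2l ?nrm_ge0.
  have := asn_ge0 NP y; rewrite /B; nra.
clearbody B.
have lowX n : N 1 <= B ^+ n * N (uin a ^+ n).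
  elim: n => [|n IH]; first by rewrite !expr0 mul1r.
  apply: le_trans IH _; rewrite exprSr -mulrA ler_wpM2l ?exprn_ge0 //.
  by rewrite exprS; exact: lowB.
(* The roots [w] stay in a disk independent of [n], so one bound [C] serves all their resolvents;
   the radius 4 B used below leaves room for the outer circle. *)
have wB z n : N (1 - z *: pw n) < 1 / 2 ->
    exists w, w ^+ n.+1 = z /\ nrm w <= 2 * B.
  move=> zn; exists (n.+1.-root z); rewrite rootCK //; split=> //.
  set w := n.+1.-root z.
  have Nz : nrm z * N (pw n) <= 2 * N 1.
    rewrite -(asnZ NP); have {1}-> : z *: pw n = 1 - (1 - z *: pw n) by ring.
    by apply: le_trans (asnD NP _ _) _; rewrite (asnN NP); lra.
  have Np : 0 < N (pw n).
    rewrite lt_def (asn_ge0 NP) andbT; apply/eqP => p0.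
    by have := lowX n.+1; rewrite -/(pw n) p0 mulr0; lra.
  have zb : nrm z <= 2 * B ^+ n.+1.
    rewrite -(ler_pM2r Np); apply: le_trans Nz _; rewrite -mulrA ler_wpM2l //.
  have : nrm w ^+ n.+1 <= (2 * B) ^+ n.+1.
    rewrite -nrmX rootCK //; apply: le_trans zb _; rewrite exprMn.
    rewrite ler_wpM2r ?exprn_ge0 // exprS ler_peMr // exprn_ege1 //; lra.
  by rewrite ler_pXn2r // nnegrE ?nrm_ge0 ?mulr_ge0.
have [|w _|C [C0 gC]] := @resolvent_bounded _ _ _ NP predT (uin a) g (4 * B).
- by [].
- exact: gP.
pose Q := 2 * B * N (uin a) * C ^+ 2 * (2 * N 1 + C).
have [n0 Qn0] := exists_nat_gt Q.
have [z [n [n0n zn]]] := near n0.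
have [w [wz w2B]] := wB z n zn.
have d0 : 0 <= (2 * n.+1%:R)^-1 :> R by rewrite invr_ge0 mulr_ge0.
have d1 : (2 * n.+1%:R)^-1 <= 1 :> R.
  by rewrite invf_le1 ?mulr_gt0 // mulr_ege1 // ?ler1n //; lra.
have [|w' ww'|E [ER EC ES]] := @power_resolvent_small _ _ _ NP (uin a) n.+1 w g C.
- by [].
- split; first exact: gP.
  apply: gC => //; have w0 := nrm_ge0 w; case: ww' => ->; first lra.
  apply: le_trans (_ : 2 * nrm w <= _); last lra.
  rewrite ler_wpM2r //.
  by move: d1; set d := (2 * _)^-1 => d1; lra.
rewrite wz -/(pw n) in ER ES; set x := z *: pw n in zn ER ES.
(* (1 - x) E is 1 up to a null element, so multiplying x E^2 by (1 - x)^2, of seminorm at most 1/4,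
   recovers [x]. *)
have xE : N x = N (x * E ^+ 2 * (1 - x) ^+ 2).
  apply: (asn_congr NP).
  have -> : x - x * E ^+ 2 * (1 - x) ^+ 2 = ((1 - x) * E - 1) * (- x * (1 + E * (1 - x))).
    by ring.
  exact: (asn_mul_eq0 NP).
have x2 : 1 / 2 <= N x.
  have : N 1 <= N (1 - x) + N x by rewrite -{1}(subrK x 1) (asnD NP).
  lra.
have xle : N x <= Q / n.+1%:R * (1 / 4).
  rewrite xE; apply: le_trans (asnM NP _ _) _.
  apply: ler_pM; rewrite ?(asn_ge0 NP) //.
    apply: le_trans ES _; rewrite ler_wpM2r ?invr_ge0 // /Q.
    rewrite ler_wpM2r ?addr_ge0 ?mulr_ge0 ?(asn_ge0 NP) //.
    by rewrite ler_wpM2r ?exprn_ge0 // ler_wpM2r ?(asn_ge0 NP).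
  apply: le_trans (NX _ 1%N) _; have := asn_ge0 NP (1 - x); nra.
have : Q / n.+1%:R < 1.
  rewrite ltr_pdivrMr // mul1r; apply: lt_le_trans Qn0 _.
  by rewrite ler_nat (leq_trans n0n).
by move: xle; set q := Q / _ => ? ?; lra.
Qed.

End Spectrum.

(** * The character *)

(** All that is later used of the character; the ideal it comes from is forgotten. *)
Record dense_character (R : realType) (V : completeNormedModType R[i])
    (mul : V -> V -> V) (H : comm_normed_algebra mul) (b : V) (phi : V -> R[i]) : Prop :=
  DenseCharacter {
    dcD : forall x y, phi (x + y) = phi x + phi y;
    dcZ : forall (z : R[i]) x, phi (z *: x) = z * phi x;
    dcM : forall x y, phi (mul x y) = phi x * phi y;
    dc_apow : forall n, phi (apow mul b n) = 1;
    dc_le : forall x, nrm (phi x) <= nrm x;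
    dc_late : forall x, phi x = 1 -> forall eps n0, 0 < eps ->
      exists n, (n0 <= n)%N /\ nrm (x - apow mul b n) < eps;
    dc_ker : forall y eps, phi y = 0 -> 0 < eps ->
      exists v, nrm (y - (v - mul b v)) < eps;
    dc_res : forall w : R[i], w != 1 ->
      exists g : unitization H, (1 - w *: uin H b) * g = 1 }.

Section Character.
Variables (R : realType) (V : completeNormedModType R[i]) (mul : V -> V -> V).
Hypothesis H : comm_normed_algebra mul.
Local Notation U := (unitization H).
Local Notation uin := (@uin R V mul H).

Lemma null_ideal J : is_ideal mul J -> is_ideal mul (fun x => dist J x = 0).
Proof.
move=> JI; split=> [|x y x0 y0|z x x0|x y x0].
- exact: (dist_eq0 JI (ideal0 JI)).
- apply/eqP; rewrite eq_le (dist_ge0 JI) andbT.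
  by apply: le_trans (distD JI _ _) _; rewrite x0 y0 addr0.
- by rewrite (distZ JI) x0 mulr0.
- apply/eqP; rewrite eq_le (dist_ge0 JI) andbT.
  by apply: le_trans (distM H JI _ _) _; rewrite x0 mul0r.
Qed.

Lemma zero_ideal : is_ideal mul (fun x => x = 0).
Proof.
split=> [|x y -> ->|z x ->|x y ->] //; rewrite ?addr0 ?scaler0 //.
by rewrite -(scale0r (0 : V)) (cnaZl H) !scale0r.
Qed.

Variable b : V.
Hypothesis bd : late_dense mul b.
Local Notation pw := (apow mul b).
Variable K : V -> Prop.
Hypothesis KI : is_ideal mul K.
Hypothesis Kb : forall x, K (x - mul x b).
Hypothesis nKb : ~ K b.

Let null x := dist K x = 0.
Let nullI : is_ideal mul null := null_ideal KI.

Lemma dist_generator_ge1 : 1 <= dist K b.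
Proof. exact: (proper_modular_dist H KI Kb nKb). Qed.

Lemma ideal_sub_apow n : K (b - pw n).
Proof.
elim: n => [|n IH]; first by rewrite subrr; exact: (ideal0 KI).
have -> : b - pw n.+1 = (b - pw n) + (pw n - mul (pw n) b).
  by rewrite subrKA (cnaC H (pw n)).
exact: (idealD KI).
Qed.

(** Modulo [K] all powers of [b] equal [b], so x ~ z b^n makes [x] a limit of multiples of [b] in
    the quotient, and that line is closed. *)
Lemma character_exists x : exists c : R[i], null (x - c *: b).
Proof.
have [||z zP] := @line_closed R V (dist K) (dist_ge0 KI) (distD KI) (distZ KI) b x.
- exact: lt_le_trans dist_generator_ge1.
- move=> eps e0; have [z [n [_ zn]]] := bd x 0%N e0; exists z.
  have -> : x - z *: b = (x - z *: pw n) - z *: (b - pw n).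
    by rewrite scalerBr opprB subrKA.
  apply: le_lt_trans (distD KI _ _) _.
  rewrite (dist_eq0 KI (idealN KI (idealZ KI _ (ideal_sub_apow n)))) addr0.
  exact: le_lt_trans (dist_le_nrm KI _) zn.
by exists z.
Qed.

Definition phi x : R[i] := sval (cid (character_exists x)).

Lemma phiP x : null (x - phi x *: b).
Proof. exact: (svalP (cid (character_exists x))). Qed.

Lemma phi_unique x c : null (x - c *: b) -> phi x = c.
Proof.
move=> xc; apply/subr0_eq/nrm0_eq0.
have : null ((phi x - c) *: b).
  have -> : (phi x - c) *: b = (x - c *: b) - (x - phi x *: b).
    by rewrite opprB [RHS]addrC subrKA scalerBl.
  by apply: (idealB nullI) => //; exact: phiP.
rewrite /null (distZ KI) => /eqP; rewrite mulf_eq0 => /orP[/eqP //|/eqP b0].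
by have := dist_generator_ge1; rewrite b0 ler10.
Qed.

Lemma phiD x y : phi (x + y) = phi x + phi y.
Proof.
apply: phi_unique; rewrite scalerDl opprD addrACA.
by apply: (idealD nullI); exact: phiP.
Qed.

Lemma phiZ (z : R[i]) x : phi (z *: x) = z * phi x.
Proof.
by apply: phi_unique; rewrite -scalerA -scalerBr; apply: (idealZ nullI); exact: phiP.
Qed.

Lemma phiN x : phi (- x) = - phi x.
Proof. by rewrite -scaleN1r phiZ mulN1r. Qed.

Lemma phiM x y : phi (mul x y) = phi x * phi y.
Proof.
apply: phi_unique.
have -> : mul x y - (phi x * phi y) *: b = mul (x - phi x *: b) y
    + (phi x *: (y - phi y *: b) - phi x *: (y - mul y b)).
  apply: (@uin_inj _ _ _ H); rewrite !(uinD, uinN, uinM, uinZA).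
  have -> : (phi x * phi y)%:A = (phi x)%:A * (phi y)%:A :> U.
    by rewrite mulr_algl scalerA.
  by ring.
apply: (idealD nullI); first by apply: (idealM nullI); exact: phiP.
apply: (idealB nullI); apply: (idealZ nullI); first exact: phiP.
exact: (dist_eq0 KI).
Qed.

Lemma phi_apow n : phi (pw n) = 1.
Proof.
apply: phi_unique; rewrite scale1r -opprB; apply: (idealN nullI).
exact: (dist_eq0 KI (ideal_sub_apow n)).
Qed.

Lemma phi_generator : phi b = 1. Proof. exact: (phi_apow 0). Qed.

Lemma phi_le x : nrm (phi x) <= nrm x.
Proof.
apply: le_trans (dist_le_nrm KI x).
have -> : dist K x = dist K (phi x *: b).
  have h : dist K (- (x - phi x *: b)) = 0 by apply: (idealN nullI); exact: phiP.
  have h1 := distD KI (x - phi x *: b) (phi x *: b).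
  have h2 := distD KI (- (x - phi x *: b)) x.
  rewrite subrK (phiP x) add0r in h1; rewrite opprB subrK -(opprB x) h add0r in h2.
  by apply/eqP; rewrite eq_le h1 h2.
by rewrite (distZ KI) ler_peMr ?nrm_ge0 // dist_generator_ge1.
Qed.

(** Applying [phi] to x ~ z b^n shows that [z] is close to 1; as |b^n| <= 2 (|x| + 1), [z] can be
    replaced by 1. *)
Lemma phi_eq1_late x : phi x = 1 -> forall eps n0, 0 < eps ->
  exists n, (n0 <= n)%N /\ nrm (x - pw n) < eps.
Proof.
move=> x1 eps n0 e0.
have M0 : 0 < 2 * nrm x + 4 by rewrite ltr_wpDl // mulr_ge0 // nrm_ge0.
pose e := Num.min (1 / 2) (eps / (2 * nrm x + 4)).
have e'0 : 0 < e by rewrite lt_min !divr_gt0.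
have [e1 e2] : e <= 1 / 2 /\ e <= eps / (2 * nrm x + 4).
  by split; rewrite ge_min lexx ?orbT.
have [z [n [nn zn]]] := bd x n0 e'0; exists n; split=> //.
have z1 : nrm (1 - z) < e.
  apply: le_lt_trans zn; have := phi_le (x - z *: pw n).
  by rewrite phiD phiN phiZ phi_apow mulr1 x1.
have z2 : 1 / 2 <= nrm z.
  have := nrmD (1 - z) z; rewrite subrK nrm1; lra.
have p1 : nrm (pw n) <= 2 * (nrm x + 1).
  have := nrmD (- (x - z *: pw n)) x.
  rewrite nrmN opprB subrK nrmZ; have := nrm_ge0 (pw n); nra.
have -> : x - pw n = (x - z *: pw n) - (1 - z) *: pw n.
  by rewrite scalerBl scale1r opprB subrKA.
apply: le_lt_trans (nrmD _ _) _; rewrite nrmN nrmZ.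
rewrite ler_pdivlMr // in e2.
have := nrm_ge0 (1 - z); have := nrm_ge0 (pw n); have := nrm_ge0 x; nra.
Qed.

Lemma apow_telescope n : exists v, b - pw n = v - mul b v.
Proof.
elim: n => [|n [v vE]].
  exists 0; rewrite subrr -(scale0r (0 : V)) (cnaZr H) !scale0r.
  by rewrite subrr.
exists (v + pw n); rewrite (cnaDr H) opprD addrACA -vE.
by rewrite subrKA.
Qed.

(** If y ~ z b^n, [phi] shows that [z] is small. Modulo (1 - b) A the power b^n equals b, so there
    [y] is close to z b, which is small. *)
Lemma ker_phi_approx y eps : phi y = 0 -> 0 < eps ->
  exists v, nrm (y - (v - mul b v)) < eps.
Proof.
move=> y0 e0; have b1 : 0 < nrm b + 1 by rewrite ltr_wpDl // nrm_ge0.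
have e1 : 0 < eps / (nrm b + 1) by rewrite divr_gt0.
have [z [n [_ zn]]] := bd y 0%N e1.
have z1 : nrm z < eps / (nrm b + 1).
  apply: le_lt_trans zn; have := phi_le (y - z *: pw n).
  by rewrite phiD phiN phiZ phi_apow mulr1 y0 add0r nrmN.
have [v vE] := apow_telescope n.
exists (- z *: v).
have -> : y - (- z *: v - mul b (- z *: v)) = (y - z *: pw n) + z *: b.
  rewrite (cnaZr H) -scalerBr -vE scaleNr opprK scalerBr.
  by rewrite addrA addrAC.
apply: le_lt_trans (nrmD _ _) _; rewrite nrmZ.
rewrite ltr_pdivlMr // in z1; rewrite ltr_pdivlMr // in zn.
have := nrm_ge0 b; have := nrm_ge0 z; have := nrm_ge0 (y - z *: pw n); nra.
Qed.

(* Otherwise b acts as w^-1 modulo a proper ideal, giving a character psi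
   <> phi; but the psi(b^n) = w^-n are not dense in the line psi {phi = 1}. *)
Lemma resolvent_exists (w : R[i]) : w != 1 -> exists g : U, (1 - w *: uin b) * g = 1.
Proof.
move=> w1; apply: contrapT => /forallNP ng.
have [w0|w0] := eqVneq w 0; first by apply: (ng 1); rewrite w0 scale0r subr0 mulr1.
pose J := ideal_add_resolvent mul (fun x => x = 0) w b.
have JI : is_ideal mul J := ideal_add_resolventP H w b zero_ideal.
have Jx x : J (x - w *: mul b x) := resolvent_sub_ideal w b x zero_ideal.
have Jb x : J (x - mul x (w *: b)) by rewrite (cnaZr H) (cnaC H).
have nJb : ~ J (w *: b).
  case=> v [j [-> ]]; rewrite addr0 => /(congr1 uin) e.
  apply: (ng (1 + uin v)).
  rewrite !(uinD, uinN, uinM, uinZ) in e.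
  rewrite mulrDr mulr1 mulrBl mul1r -scalerAl.
  by rewrite -e subrK.
have d1 := proper_modular_dist H JI Jb nJb.
have db : 0 < dist J b.
  rewrite lt_def (dist_ge0 JI) andbT; apply/eqP => b0.
  by move: d1; rewrite (distZ JI) b0 mulr0 ler10.
have eqd x y : J (x - y) -> dist J x = dist J y.
  move=> xy; have h1 := distD JI (x - y) y; have h2 := distD JI (- (x - y)) x.
  rewrite subrK (dist_eq0 JI xy) add0r in h1.
  rewrite (dist_eq0 JI (idealN JI xy)) add0r opprB subrK in h2.
  by apply/eqP; rewrite eq_le h1 h2.
have dpS n : dist J (pw n) = nrm w * dist J (pw n.+1).
  by rewrite -(distZ JI); apply: eqd; exact: Jx.
have dp n : dist J b = nrm w ^+ n * dist J (pw n).
  by elim: n => [|n ->]; rewrite ?expr0 ?mul1r // dpS exprSr mulrA.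
have near x n : nrm (x - pw n) < dist J b -> dist J x < dist J (pw n) + dist J b.
  move=> h; have := distD JI (x - pw n) (pw n); rewrite subrK.
  have := dist_le_nrm JI (x - pw n); lra.
have phi2 : phi (b - w *: mul b b) = 1 - w.
  by rewrite phiD phiN phiZ phiM phi_generator !mulr1.
(* For |w| <= 1 the powers of [b] keep distance at least [dist J b] from [J], but some x with phi x
   = 1 lies in [J]. For |w| > 1 their distance is at most [dist J b], but some such x has distance 3
   [dist J b]. *)
have [wle|wgt] := leP (nrm w) 1.
  have w1' : 1 - w != 0 by rewrite subr_eq0 eq_sym.
  pose x := (1 - w)^-1 *: (b - w *: mul b b).
  have x1 : phi x = 1 by rewrite phiZ phi2 mulVf.
  have x0 : dist J x = 0 by apply: (dist_eq0 JI); apply: (idealZ JI); exact: Jx.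
  have [n [_ xn]] := phi_eq1_late x1 0%N db.
  have := distD JI (- (x - pw n)) x; rewrite x0 opprB subrK addr0.
  have := dist_le_nrm JI (pw n - x); rewrite nrm_distC.
  have : dist J b <= dist J (pw n).
    by rewrite (dp n) ler_piMl ?(dist_ge0 JI) // exprn_ile1 ?nrm_ge0.
  by lra.
have w1' : w - 1 != 0 by rewrite subr_eq0.
(* Modulo [J], w b^2 = b, so the coefficient makes x = 3 b, while phi (b - b^2) = 0. *)
pose x := b + (2 * w / (w - 1)) *: (b - mul b b).
have x1 : phi x = 1.
  by rewrite phiD phiZ phiD phiN phiM phi_generator mulr1 subrr mulr0 addr0.
have x3 : dist J x = 3 * dist J b.
  rewrite -[3]nrm_nat -(distZ JI); apply: eqd.
  have -> : x - 3%:R *: b = (2 / (w - 1)) *: (b - w *: mul b b).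
    rewrite /x; move: (mul b b) => c.
    have -> : 2 / (w - 1) *: (b - w *: c) = (2 / (w - 1)) *: b - (2 * w / (w - 1)) *: c.
      by rewrite scalerBr scalerA mulrAC.
    have -> : 2 / (w - 1) = 1 + 2 * w / (w - 1) - 3%:R by field.
    by rewrite [in RHS]scalerBl (scalerDl b 1 (2 * w / _)) scale1r scalerBr addrA [RHS]addrAC.
  by apply: (idealZ JI); exact: Jx.
have [n [_ xn]] := phi_eq1_late x1 0%N db.
have := near _ _ xn; rewrite x3.
have : dist J (pw n) <= dist J b.
  by rewrite (dp n) ler_peMl ?(dist_ge0 JI) // exprn_ege1 // ltW.
by lra.
Qed.

Lemma dense_character_exists : exists psi, dense_character H b psi.
Proof.
exists phi; split; [exact: phiD|exact: phiZ|exact: phiM|exact: phi_apow|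
  exact: phi_le|exact: phi_eq1_late|exact: ker_phi_approx|exact: resolvent_exists].
Qed.

End Character.

(** * The unit *)

Section Unit.
Variables (R : realType) (V : completeNormedModType R[i]) (mul : V -> V -> V).
Hypothesis H : comm_normed_algebra mul.
Local Notation U := (unitization H).
Local Notation uin := (@uin R V mul H).
Local Notation N := (@unitz_nrm R V mul H).
Variables (b : V) (phi : V -> R[i]).
Hypothesis bd : late_dense mul b.
Hypothesis bphi : dense_character H b phi.
Local Notation pw := (apow mul b).

Let NP : alg_seminorm N := unitz_nrm_asn H.

Lemma unitz_nrm_eq0 (x : U) : N x = 0 -> x = 0.
Proof.
move=> x0; have h1 := nrm_ge0 (x.1 : R[i]); have h2 := nrm_ge0 x.2.
rewrite /unitz_nrm in x0.
have e1 : nrm (x.1 : R[i]) = 0 by apply/eqP; rewrite eq_le h1 andbT; lra.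
have e2 : nrm x.2 = 0 by apply/eqP; rewrite eq_le h2 andbT; lra.
by rewrite [x]unitzE (nrm0_eq0 e1) (nrm0_eq0 e2) scale0r add0r.
Qed.

Lemma unitz_inv_unique (x y z : U) : x * y = 1 -> x * z = 1 -> y = z.
Proof. by move=> xy xz; rewrite -[y]mulr1 -xz mulrCA mulrA xy mul1r. Qed.

Definition double_pow n : U := (2 : R[i]) ^+ n.+1 *: uin b ^+ n.+1.

(* All powers of w b with [nrm w = 2] have resolvents bounded by one constant,
   since the circle [nrm w = 2] stays away from the singularity w = 1. *)
Lemma double_pow_resolvents : exists C Q : R, [/\ 0 <= C, 0 <= Q &
  forall n (mu : R[i]), nrm mu = 1 -> exists E : U,
    [/\ (1 - mu *: double_pow n) * E = 1, N E <= C &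
        N (double_pow n * E ^+ 2) <= Q / n.+1%:R]].
Proof.
have /choice[g gP] (w : R[i]) : exists g : U, w != 1 -> (1 - w *: uin b) * g = 1.
  have [w1|w1] := eqVneq w 1; first by exists 0.
  by have [g gw] := dc_res bphi w1; exists g.
(* [S] is a closed region containing the annulus 2 <= |w| <= 4, hence both circles of
   [power_resolvent_small]. *)
pose S (w : R[i]) := 1 / 2 <= nrm (w - 1).
have S1 w : S w -> w != 1.
  by apply: contraTneq => ->; rewrite /S subrr nrm0 -ltNge divr_gt0.
have gN w : S w -> N ((1 - w *: uin b) * g w - 1) = 0.
  by move=> /S1/gP ->; rewrite subrr (asn0 NP).
have [w|C [C0 gC]] := @resolvent_bounded _ _ _ NP S (uin b) g 4 _ gN.
  rewrite /S -ltNge => Sw; exists (1 / 2 - nrm (w - 1)); split; first by rewrite subr_gt0.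
  move=> w' ww'; rewrite -ltNge -(subrKA w w' (- 1)).
  by apply: le_lt_trans (nrmD _ _) _; rewrite -ltrBrDr.
pose Q := 2 * N (uin b) * C ^+ 2 * (2 * N 1 + C).
have Q0 : 0 <= Q.
  have N0 x := asn_ge0 NP x.
  by apply: mulr_ge0; [apply: mulr_ge0; [exact: mulr_ge0|exact: exprn_ge0]|apply: addr_ge0; [exact: mulr_ge0|]].
exists C, Q; split=> // n mu mu1.
pose w := 2 * n.+1.-root mu.
have w2 : nrm w = 2.
  have r1 : nrm (n.+1.-root mu) = 1.
    have : nrm (n.+1.-root mu) ^+ n.+1 = 1 by rewrite -nrmX rootCK.
    by move=> /eqP; rewrite pexprn_eq1 ?nrm_ge0 //= => /eqP.
  by rewrite nrmM r1 mulr1 nrm_nat.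
have wmu : w ^+ n.+1 *: uin b ^+ n.+1 = mu *: double_pow n.
  by rewrite /double_pow scalerA exprMn rootCK // mulrC.
have [|w' ww'|E [ER EC ES]] := @power_resolvent_small _ _ _ NP (uin b) n.+1 w g C.
- by [].
- have d0 : 0 <= (2 * n.+1%:R)^-1 :> R by rewrite invr_ge0 mulr_ge0.
  have d1 : (2 * n.+1%:R)^-1 <= 1 :> R.
    by rewrite invf_le1 ?mulr_gt0 // mulr_ege1 // ?ler1n //; lra.
  have [h1 h2] : 2 <= nrm w' /\ nrm w' <= 4.
    move: d0 d1 ww'; rewrite w2; set d := (2 * _)^-1 => d0 d1.
    by case=> ->; split; lra.
  have Sw' : S w'.
    rewrite /S; have := nrmD (w' - 1) 1; rewrite subrK nrm1; lra.
  by split; [exact: gN|exact: gC].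
exists E; split=> //.
  by apply/subr0_eq/unitz_nrm_eq0; rewrite -wmu.
have -> : N (double_pow n * E ^+ 2) = N (mu *: double_pow n * E ^+ 2).
  by rewrite -[in RHS]scalerAl [RHS](asnZ NP) mu1 mul1r.
by rewrite -wmu; apply: le_trans ES _; rewrite w2 /Q lexx.
Qed.

(* The resolvents of x = (2b)^n tend to the spectral projection of b
   complementary to the eigenvalue 1. *)
Lemma double_pow_cauchy : exists (G : nat -> U) (M : R), [/\ 0 <= M,
  forall n, (1 - double_pow n) * G n = 1 &
  forall n m, N (G n - G m) <= M / n.+1%:R + M / m.+1%:R].
Proof.
have [C [Q [C0 Q0 CQ]]] := double_pow_resolvents.
have /choice[G GP] n := CQ n 1 (nrm1 R).
have GE n : (1 - double_pow n) * G n = 1 by have [] := GP n; rewrite scale1r.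
pose M := 2 * Q * (1 + 2 * C).
have M0 : 0 <= M by rewrite !mulr_ge0 // addr_ge0 // mulr_ge0.
(* [G] at the exponent (n + 1)(m + 1) is the average of the inverses of 1 - mu (2 b)^(n + 1) over
   the (m + 1)-th roots of unity mu, each within M / (n + 1) of [G n]. Comparing through this common
   exponent gives the Cauchy estimate. *)
have half n m : N (G (n.+1 * m.+1).-1 - G n) <= M / n.+1%:R.
  have [om omP] := closed_prim_root_exists R[i] (ltn0Sn m).
  have om1 j : nrm (om ^+ j) = 1.
    have om1 : nrm om ^+ m.+1 = 1 by rewrite -nrmX (prim_expr_order omP) nrm1.
    move/eqP: om1; rewrite pexprn_eq1 ?nrm_ge0 //= => /eqP om1.
    by rewrite nrmX om1 expr1n.
  have /choice[F FP] mu : exists F : U, nrm mu = 1 -> [/\ (1 - mu *: double_pow n) * F = 1,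
      N F <= C & N (double_pow n * F ^+ 2) <= Q / n.+1%:R].
    have [mu1|mu1] := eqVneq (nrm mu) 1; last by exists 0 => /eqP; rewrite (negPf mu1).
    by have [F FP] := CQ n mu mu1; exists F.
  pose E j := F (om ^+ j); have EP j := FP _ (om1 j).
  pose x := double_pow n.
  pose avg := (m.+1%:R : R[i])^-1 *: \sum_(j < m.+1) E j.
  have avgE : avg = G (n.+1 * m.+1).-1.
    apply: unitz_inv_unique (GE _).
    have -> : double_pow (n.+1 * m.+1).-1 = 1 ^+ m.+1 *: x ^+ m.+1.
      by rewrite expr1n scale1r /x /double_pow exprZn -!exprM prednK // muln_gt0.
    apply/subr0_eq/unitz_nrm_eq0.
    have -> : avg = (m.+1%:R : R[i])^-1 *: \sum_(j < m.+1) F (om ^+ j * 1).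
      by congr (_ *: _); apply: eq_bigr => j _; rewrite mulr1.
    apply: (resolvent_average NP omP) => j; rewrite mulr1.
    by have [-> _ _] := EP j; rewrite subrr (asn0 NP).
  have Ej j : N (E j - G n) <= M / n.+1%:R.
    have [Ej1 EjC _] := EP j; have [_ _ GQ] := GP n.
    (* The resolvent identity E - G = (o - 1) x G E with o = om^j; rewriting o E as G (1 + (o - 1)
       E) produces the small element x G^2. *)
    have id : om ^+ j *: (E j - G n) =
        (om ^+ j - 1) *: (x * G n ^+ 2 * (1 + (om ^+ j - 1) *: E j)).
      have h1 := Ej1; have h2 := GE n; rewrite -/x in h1 h2.
      rewrite -(mulr_algl _ (E j)) -(mulr_algl _ (x * _ * _)) -(mulr_algl _ (E j - _)).
      rewrite scalerBl scale1r.
      rewrite -(mulr_algl _ x) in h1; move: h1; set o := (om ^+ j)%:A => h1.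
      have e1 : o * E j = G n * (1 + (o - 1) * E j).
        transitivity (o * E j * ((1 - x) * G n)); first by rewrite h2 mulr1.
        transitivity (G n * ((1 - o * x) * E j + (o - 1) * E j)); first ring.
        by rewrite h1.
      transitivity (o * E j * ((1 - x) * G n) - o * G n * ((1 - o * x) * E j)).
        by rewrite h1 h2; ring.
      transitivity ((o - 1) * (x * G n * (o * E j))); first ring.
      by rewrite e1; ring.
    have -> : N (E j - G n) = N (om ^+ j *: (E j - G n)).
      by rewrite (asnZ NP) om1 mul1r.
    rewrite id (asnZ NP).
    have o2 : nrm (om ^+ j - 1) <= 2.
      by apply: le_trans (nrmD _ _) _; rewrite nrmN om1 nrm1.
    have h1 : N (1 + (om ^+ j - 1) *: E j) <= 1 + 2 * C.
      apply: le_trans (asnD NP _ _) _; rewrite unitz_nrm1 lerD2l (asnZ NP).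
      by rewrite ler_pM ?nrm_ge0 ?(asn_ge0 NP).
    have -> : M / n.+1%:R = 2 * (Q / n.+1%:R * (1 + 2 * C)) by rewrite /M; ring.
    rewrite ler_pM ?nrm_ge0 ?(asn_ge0 NP) //.
    by apply: le_trans (asnM NP _ _) _; rewrite ler_pM ?(asn_ge0 NP).
  rewrite -avgE; have -> : avg - G n = (m.+1%:R : R[i])^-1 *: \sum_(j < m.+1) (E j - G n).
    rewrite sumrB sumr_const card_ord scalerBr; congr (_ - _).
    by rewrite -(scaler_nat _ (G n)) scalerA mulVf ?scale1r // pnatr_eq0.
  have := @asn_average _ _ _ NP 'I_m.+1 (fun j => E j - G n) (M / n.+1%:R).
  by rewrite card_ord; apply.
exists G, M; split=> // n m.
have h1 := half n m; have h2 := half m n; rewrite mulnC in h2.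
set k := (n.+1 * m.+1).-1 in h1 h2.
have -> : G n - G m = - (G k - G n) + (G k - G m) by ring.
by apply: le_trans (asnD NP _ _) _; rewrite (asnN NP) lerD.
Qed.

(** The resolvents have the form 1 - f_n with b^(n+1) f_n = b^(n+1) + 2^-(n+1) f_n, and f_n tends to
    some e. As b is a limit of its powers, b e = b; hence e fixes all powers of b, and by density
    everything. *)
Lemma unit_exists : exists e, forall x, mul x e = x.
Proof.
have [G [M [M0 GE GM]]] := double_pow_cauchy.
have G1 n : (G n).1 = 1.
  have dp1 : (double_pow n).1 = 0 by rewrite /double_pow -uin_apow; exact: mulr0.
  have /(congr1 fst) := GE n; rewrite unitz_fstM.
  have -> : (1 - double_pow n).1 = 1 - (double_pow n).1 by [].
  by rewrite dp1 subr0 mul1r.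
have [e eP] : exists e, forall eps, 0 < eps ->
    exists n0, forall n, (n0 <= n)%N -> nrm ((- (G n).2) - e) < eps.
  apply: cauchy_limit => eps e0.
  have [n0 n0P] := exists_nat_gt (2 * M / eps).
  exists n0 => n m nn nm; rewrite -opprD nrmN.
  have -> : nrm ((G n).2 - (G m).2) = N (G n - G m).
    by rewrite /unitz_nrm /= !G1 subrr nrm0 add0r.
  apply: le_lt_trans (GM n m) _.
  have small k : (n0 <= k)%N -> M / k.+1%:R < eps / 2.
    move=> nk; rewrite ltr_pdivrMr //.
    have : n0%:R < k.+1%:R :> R by rewrite ltr_nat ltnS.
    rewrite ltr_pdivrMr // in n0P; nra.
  by rewrite [eps]splitr ltrD ?small.
exists e.
have be : mul b e = b.
  apply/esym/subr0_eq/nrm_small_eq0 => eps e0.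
  pose K := (1 + nrm e) + (nrm e + 1) + (nrm b + 1) + 1.
  have K0 : 0 < K by have := nrm_ge0 e; have := nrm_ge0 b; rewrite /K; lra.
  pose d := Num.min 1 (eps / K).
  have d0 : 0 < d by rewrite lt_min ltr01 divr_gt0.
  have [d1 d2] : d <= 1 /\ d <= eps / K by split; rewrite ge_min lexx ?orbT.
  have [n1 n1P] := eP _ d0.
  have half01 : 0 <= (1 / 2 : R) < 1 by apply/andP; split; lra.
  have [n2 n2P] := expr_eventually_small half01 d0.
  have [n [nn bn]] := dc_late bphi (dc_apow bphi 0) (maxn n1 n2) d0.
  rewrite /= geq_max in bn nn; have /andP[nn1 nn2] := nn.
  have en := n1P n nn1; set f := - (G n).2 in en.
  have Gf : G n = 1 - uin f by rewrite [LHS]unitzE G1 scale1r uinN opprK.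
  have pf : mul (pw n) f = pw n + (1 / 2) ^+ n.+1 *: f.
    have := GE n; rewrite Gf /double_pow -uin_apow => h.
    have t0 : (2 : R[i]) ^+ n.+1 != 0 by rewrite expf_neq0 // pnatr_eq0.
    have h' : 2 ^+ n.+1 *: (uin (pw n) * uin f) = 2 ^+ n.+1 *: uin (pw n) + uin f.
      apply: subr0_eq.
      transitivity ((1 - 2 ^+ n.+1 *: uin (pw n)) * (1 - uin f) - 1); last first.
        by rewrite h subrr.
      by rewrite -(mulr_algl _ (_ * _)) -(mulr_algl _ (uin (pw n))); ring.
    apply: (@uin_inj _ _ _ H); rewrite uinM uinD uinZ.
    apply: (scalerI t0); rewrite h' scalerDr scalerA -exprMn mulrCA divff ?pnatr_eq0 //.
    by rewrite mulr1 expr1n scale1r.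
  have -> : b - mul b e = ((b - pw n) - mul (b - pw n) e)
      + ((pw n - mul (pw n) f) + mul (pw n) (f - e)).
    by apply: (@uin_inj _ _ _ H); rewrite !(uinD, uinN, uinM); ring.
  have -> : pw n - mul (pw n) f = - ((1 / 2) ^+ n.+1 *: f).
    by rewrite pf opprD addrA subrr sub0r.
  have h1 := nrmD (b - pw n - mul (b - pw n) e)
     (- ((1 / 2) ^+ n.+1 *: f) + mul (pw n) (f - e)).
  have h2 := nrmD (b - pw n) (- mul (b - pw n) e).
  have h3 := cna_nrm H (b - pw n) e.
  have h4 := nrmD (- ((1 / 2) ^+ n.+1 *: f)) (mul (pw n) (f - e)).
  have h5 := cna_nrm H (pw n) (f - e).
  have h6 := nrmD (f - e) e; rewrite subrK in h6.
  have h7 := nrmD (- (b - pw n)) b; rewrite opprB subrK nrm_distC in h7.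
  have h8 : nrm ((1 / 2 : R[i]) ^+ n.+1) < d.
    rewrite nrmX nrmM nrm1 nrmV (nrm_nat R 2); apply: n2P; exact: leqW.
  rewrite nrmN in h2; rewrite nrmN nrmZ in h4.
  have dK : d * K <= eps by rewrite -ler_pdivlMr.
  have k1 : nrm (b - pw n) * nrm e <= d * nrm e by rewrite ler_wpM2r ?nrm_ge0 ?ltW.
  have k2 : nrm ((1 / 2 : R[i]) ^+ n.+1) * nrm f <= d * (nrm e + 1).
    by rewrite ler_pM ?nrm_ge0 ?ltW //; lra.
  have k3 : nrm (pw n) * nrm (f - e) <= (nrm b + 1) * d.
    by rewrite ler_pM ?nrm_ge0 ?ltW //; lra.
  by rewrite /K in dK; lra.
have pe n : mul (pw n) e = pw n.
  by elim: n => // n IH; rewrite /= -(cnaA H) IH.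
move=> x; apply/esym/subr0_eq/nrm_small_eq0 => eps e0.
have e1 : 0 < 1 + nrm e by rewrite ltr_pwDl // nrm_ge0.
have d0 : 0 < eps / (1 + nrm e) by rewrite divr_gt0.
have [z [n [_ zn]]] := bd x 0%N d0.
set y := x - z *: pw n in zn.
have -> : x - mul x e = y - mul y e.
  rewrite /y (cnaDl H) -scaleNr (cnaZl H) pe scaleNr.
  by rewrite opprD opprK addrACA addNr addr0.
apply: le_lt_trans (nrmD _ _) _; rewrite nrmN.
have := cna_nrm H y e; rewrite ltr_pdivlMr // in zn; lra.
Qed.

End Unit.

(** * The contradiction and the theorem *)

Section Contradiction.
Variables (R : realType) (V : completeNormedModType R[i]) (mul : V -> V -> V).
Hypothesis H : comm_normed_algebra mul.
Local Notation U := (unitization H).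
Local Notation uin := (@uin R V mul H).
Variables (b : V) (phi : V -> R[i]).
Hypothesis bd : late_dense mul b.
Hypothesis bphi : dense_character H b phi.
Local Notation pw := (apow mul b).

Section WithUnit.
Variable e : V.
Hypothesis mulVe : forall x, mul x e = x.

Lemma phi_unit : phi e = 1.
Proof.
have := dc_apow bphi 0; have := dcM bphi b e; rewrite mulVe /=.
by move=> /[swap] ->; rewrite mul1r.
Qed.

(** If x A were proper, 1 - w b would be singular modulo x A for some w, and w = 1 because the
    others are invertible. Then x A + (1 - b) A is proper, at distance at least 1 from [e]; but e -
    x / phi x lies in ker phi, where (1 - b) A is dense. *)
Lemma phi_neq0_inv x : phi x != 0 -> exists v, mul x v = e.
Proof.
move=> x0; apply: contrapT => /forallNP nx.
pose J y := exists v, y = mul x v.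
have JI : is_ideal mul J.
  split=> [|_ _ [v ->] [v' ->]|z _ [v ->]|_ y [v ->]].
  - by exists 0; rewrite -(scale0r (0 : V)) (cnaZr H) !scale0r.
  - by exists (v + v'); rewrite (cnaDr H).
  - by exists (z *: v); rewrite (cnaZr H).
  - by exists (mul v y); rewrite (cnaA H).
have Je y : J (y - mul y e) by rewrite mulVe subrr; exact: (ideal0 JI).
have nJe : ~ J e by case=> v /esym; exact: nx.
have [w nw] := modular_spectrum H JI Je nJe bd.
have [w1|w1] := eqVneq w 1; last first.
  have [g gE] := dc_res bphi w1; apply: nw.
  pose v := g.1 *: e + mul e g.2.
  exists v, 0; split; first exact: (ideal0 JI).
  apply: (@uin_inj _ _ _ H); rewrite addr0 uinB uinZ uinM.
  have -> : uin v = uin e * g by rewrite uin_mul.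
  by rewrite -[LHS]mulr1 -gE -(mulr_algl _ (_ * (_ * _))) -(mulr_algl _ (uin b)); ring.
rewrite w1 in nw.
have KI := ideal_add_resolventP H 1 b JI.
have Ke y : ideal_add_resolvent mul J 1 b (y - mul y e).
  by rewrite mulVe subrr; exact: (ideal0 KI).
have d1 := proper_modular_dist H KI Ke nw.
have y0 : phi (e - (phi x)^-1 *: x) = 0.
  by rewrite (dcD bphi) -scaleNr (dcZ bphi) phi_unit mulNr mulVf // subrr.
have [v ve] := dc_ker bphi y0 (@ltr01 R).
have Kv : ideal_add_resolvent mul J 1 b ((phi x)^-1 *: x + (v - mul b v)).
  exists v, ((phi x)^-1 *: x); split; last by rewrite scale1r addrC.
  by apply: (idealZ JI); exists e; rewrite mulVe.
have := dist_le e Kv; rewrite opprD addrA.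
by lra.
Qed.

Let Phi (x : U) := x.1 + phi x.2.

Let phi0 : phi 0 = 0.
Proof. by rewrite -(scale0r (0 : V)) (dcZ bphi) mul0r. Qed.

Let PhiD x y : Phi (x + y) = Phi x + Phi y.
Proof. by rewrite /Phi /= (dcD bphi) addrACA. Qed.

Let PhiM x y : Phi (x * y) = Phi x * Phi y.
Proof. by rewrite /Phi /= !(dcD bphi) !(dcZ bphi) (dcM bphi); ring. Qed.

Let Phi1 : Phi 1 = 1. Proof. by rewrite /Phi /= phi0 addr0. Qed.

Let PhiX x n : Phi (x ^+ n) = Phi x ^+ n.
Proof. by elim: n => // n IH; rewrite !exprS PhiM IH. Qed.

Let Phi_uin x : Phi (uin x) = phi x. Proof. exact: add0r. Qed.

Lemma generator_near_unit n : nrm (pw n - e) <= 1 / 8 ->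
  nrm (b - e) <= (4 * n.+1%:R)^-1.
Proof.
move=> near.
have [||||||r [r0 rle rE]] := @nth_root_near_one R V mul H (fun x => phi x = 0)
  n.+1 (pw n - e) isT near.
- exact: phi0.
- by move=> x z x0 z0; rewrite (dcD bphi) x0 z0 addr0.
- by move=> c x x0; rewrite (dcZ bphi) x0 mulr0.
- by move=> x z x0; rewrite (dcM bphi) x0 mul0r.
- move=> x xs; apply: nrm_small_eq0 => eps /xs[y [y0 xy]].
  apply: le_lt_trans xy; have := dc_le bphi (x - y).
  by rewrite (dcD bphi) -scaleN1r (dcZ bphi) y0 mulr0 addr0.
- by rewrite (dcD bphi) -scaleN1r (dcZ bphi) (dc_apow bphi) phi_unit mulN1r subrr.
suff -> : b - e = r by [].
(* [S] is the cofactor of b - (1 + r) in b^(n+1) - (1 + r)^(n+1). Both bases have character 1, so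
   its terms add up to n + 1 under [Phi]. *)
pose S := \sum_(i < n.+1) uin b ^+ (n - i) * (1 + uin r) ^+ i.
have PhiS : Phi S = n.+1%:R.
  rewrite /S (big_morph Phi PhiD (_ : Phi 0 = 0)); last by rewrite /Phi /= phi0 addr0.
  under eq_bigr => i _.
    rewrite PhiM !PhiX PhiD Phi1 !Phi_uin r0 addr0 (dc_apow bphi 0) !expr1n mulr1.
    over.
  by rewrite sumr_const card_ord.
pose z := S.1 *: e + mul e S.2.
have zE : uin z = uin e * S by rewrite uin_mul.
have phiz : phi z != 0.
  by rewrite -Phi_uin zE PhiM Phi_uin phi_unit mul1r PhiS pnatr_eq0.
have [v zv] := phi_neq0_inv phiz.
have ee : uin e * uin e = uin e by rewrite -uinM mulVe.
(* Multiplying by [e] identifies the unit of the unitization with [e], and e (b^(n+1) - 1 - (b^(n+1)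
   - e)) = 0. *)
have kill : uin (b - e - r) * uin z = 0.
  have be : uin b * uin e = uin b by rewrite -uinM mulVe.
  have re : uin r * uin e = uin r by rewrite -uinM mulVe.
  transitivity (uin e * ((uin b - (1 + uin r)) * S)).
    rewrite zE !uinB mulrA mulrA; congr (_ * S).
    rewrite !mulrBl mulrBr mulrDr mulr1 be ee re.
    by rewrite ![uin e * _]mulrC be re opprD addrA.
  rewrite /S -subrXX rE -uin_apow uinB.
  have pe : uin e * uin (pw n) = uin (pw n) by rewrite -uinM (cnaC H) mulVe.
  by rewrite mulrBr pe mulrDr mulrBr pe mulr1 ee; ring.
apply: subr0_eq; rewrite -[LHS]mulVe.
have -> : mul (b - e - r) e = mul (mul (b - e - r) z) v by rewrite -(cnaA H) zv.
have -> : mul (b - e - r) z = 0 by apply: (@uin_inj _ _ _ H); rewrite uinM kill.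
by rewrite -(scale0r (0 : V)) (cnaZl H) !scale0r.
Qed.

Lemma generator_eq_unit : b = e.
Proof.
apply/subr0_eq/nrm_small_eq0 => eps e0.
have [n0 n0P] := exists_nat_gt eps^-1.
have e8 : 0 < 1 / 8 :> R by rewrite divr_gt0.
have [n [nn en]] := dc_late bphi phi_unit n0 e8.
rewrite nrm_distC in en.
apply: le_lt_trans (generator_near_unit (ltW en)) _.
rewrite -[eps]invrK ltf_pV2 ?posrE ?invr_gt0 ?mulr_gt0 //.
apply: lt_le_trans n0P _; rewrite -natrM ler_nat.
by rewrite (leq_trans nn) // (leq_trans (leqnSn n)) // leq_pmull.
Qed.

End WithUnit.

(** When b = e, the subspace (1 - b) A is 0, yet dense in ker phi; so every y is the multiple of e
    by phi y. *)
Lemma dense_character_dim1 : ~ dim_gt1 V.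
Proof.
move=> dimV; have [e eP] := unit_exists bd bphi.
have be := generator_eq_unit eP.
have [y yP] := not_line dimV e; apply: (yP (phi y)).
apply/subr0_eq/nrm_small_eq0 => eps e0.
have y0 : phi (y - phi y *: e) = 0.
  by rewrite (dcD bphi) -scaleNr (dcZ bphi) (phi_unit eP) mulr1 subrr.
have [v] := dc_ker bphi y0 e0.
by rewrite be (cnaC H) eP subrr subr0.
Qed.

End Contradiction.

(** * Commutativity, modular ideals, infinite dimension and weak amenability *)

Section Supercyclic.
Variables (R : realType) (V : completeNormedModType R[i]) (mul : V -> V -> V).

(** For a suitable w, adjoining (1 - w a) A to a proper modular J keeps it proper and makes w a a
    modular unit, which produces the dense character excluded above. *)
Lemma no_proper_modular_ideal (H : comm_normed_algebra mul) (a : V)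
  (J : V -> Prop) (u : V) : dim_gt1 V -> late_dense mul a ->
  is_ideal mul J -> (forall x, J (x - mul x u)) -> J u.
Proof.
move=> dimV ad JI Ju; apply: contrapT => nJu.
have [w nw] := modular_spectrum H JI Ju nJu ad.
pose K := ideal_add_resolvent mul J w a; rewrite -/K in nw.
have KI : is_ideal mul K := ideal_add_resolventP H w a JI.
have Kx x : K (x - w *: mul a x) := resolvent_sub_ideal w a x JI.
have w0 : w != 0.
  by apply/eqP => w0; apply: nw; have := Kx u; rewrite w0 scale0r subr0.
have Kb x : K (x - mul x (w *: a)) by rewrite (cnaZr H) (cnaC H).
have nKb : ~ K (w *: a).
  move=> /(idealM KI u); rewrite (cnaZl H) => Kau; apply: nw.
  by rewrite -(subrK (w *: mul a u) u); apply: (idealD KI).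
have bd : late_dense mul (w *: a) := late_denseZ (cnaZl H) (cnaZr H) w0 ad.
have [phi phiP] := dense_character_exists H bd KI Kb nKb.
exact: (dense_character_dim1 bd phiP dimV).
Qed.

Lemma dense_eq0 (W : normedZmodType R[i]) (a : V) (g : V -> W) (M : R) :
  (forall x eps, 0 < eps -> exists (z : R[i]) n, nrm (x - z *: apow mul a n) < eps) ->
  (forall x y, g (x - y) = g x - g y) -> (forall x, nrm (g x) <= M * nrm x) ->
  (forall z n, g (z *: apow mul a n) = 0) -> forall x, g x = 0.
Proof.
move=> ad gB gM g0 x; apply: nrm_small_eq0 => eps e0.
have M1 : 0 < `|M| + 1 by rewrite ltr_wpDl.
have [z [n zn]] := ad x _ (divr_gt0 e0 M1).
have := gM (x - z *: apow mul a n); rewrite gB g0 subr0 => /le_lt_trans; apply.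
apply: le_lt_trans (_ : (`|M| + 1) * nrm (x - z *: apow mul a n) < _).
  by rewrite ler_wpM2r ?nrm_ge0 //; have := ler_norm M; lra.
by rewrite mulrC -ltr_pdivlMr.
Qed.

Lemma apow_mul a n m : associative mul ->
  mul (apow mul a n) (apow mul a m) = apow mul a (n + m).+1.
Proof. by move=> mulA; elim: n => [//|n IH]; rewrite /= -mulA IH. Qed.

(** The commutator is continuous in each variable and vanishes on powers of [a], so density is used
    once per variable. *)
Lemma supercyclic_comm a : is_banach_algebra mul ->
  (forall x eps, 0 < eps -> exists (z : R[i]) n, nrm (x - z *: apow mul a n) < eps) ->
  comm_normed_algebra mul.
Proof.
move=> [[mA mDl mDr mZl mZr] mN] ad.
have mN' x y : nrm (mul x y) <= nrm x * nrm y.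
  by rewrite -lecR rmorphM /= -!nrmE mN.
split=> // x y.
have mBl z t s : mul (z - t) s = mul z s - mul t s by rewrite mDl -scaleN1r mZl scaleN1r.
have mBr z t s : mul s (z - t) = mul s z - mul s t by rewrite mDr -scaleN1r mZr scaleN1r.
have comm_le s t : nrm (mul s t - mul t s) <= 2 * nrm s * nrm t.
  apply: le_trans (nrmD _ _) _; rewrite nrmN.
  have := mN' s t; have := mN' t s; lra.
have pC s n : mul (apow mul a n) s - mul s (apow mul a n) = 0.
  move: s; apply: (@dense_eq0 _ a _ (2 * nrm (apow mul a n)) ad).
  - move=> s t; rewrite mBl mBr !opprB [LHS]addrACA [RHS]addrACA.
    by congr (_ + _); exact: addrC.
  - by move=> s; exact: comm_le.
  - by move=> z m; rewrite mZl mZr !apow_mul // addnC subrr.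
apply: subr0_eq; move: x; apply: (@dense_eq0 _ a _ (2 * nrm y) ad).
- move=> s t; rewrite mBl mBr !opprB [LHS]addrACA [RHS]addrACA.
  by congr (_ + _); exact: addrC.
- by move=> s; rewrite mulrAC; exact: comm_le.
- by move=> z m; rewrite mZl mZr -scalerBr pC scaler0.
Qed.

Lemma infinite_dim_of_no_modular (H : comm_normed_algebra mul) a : dim_gt1 V ->
  late_dense mul a -> infinite_dim V.
Proof.
move=> dimV ad n; apply: contrapT => /forallNP /(_ (fun i : 'I_n => apow mul a i)).
move=> /existsNP[c] /not_implyP[c0 /existsNP[i0 ci0]].
have [k /eqP ck kmin] : exists2 k : 'I_n, c k != 0 &
    forall i : 'I_n, (i < k)%N -> c i = 0.
  have ex : exists i : nat, [exists j : 'I_n, (val j == i) && (c j != 0)].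
    by exists i0; apply/existsP; exists i0; rewrite eqxx; apply/eqP.
  case: (ex_minnP ex) => m /existsP[k /andP[/eqP km ck]] mmin.
  exists k => // i; rewrite km => im; apply/eqP/negPn/negP => ci.
  have /mmin : [exists j : 'I_n, (val j == i) && (c j != 0)].
    by apply/existsP; exists i; rewrite eqxx.
  by rewrite leqNgt im.
(* Solving the relation for its lowest power, [apow mul a k]; [apow] is shifted by one, so the
   factor left from index [i] has index i - k - 1. *)
pose q := \sum_(i < n | i != k)
  if (k < i)%N then (- c i / c k) *: apow mul a (i - k).-1 else 0.
have pq : apow mul a k = mul (apow mul a k) q.
  have mul_sum : mul (apow mul a k) q = \sum_(i < n | i != k)
     mul (apow mul a k)
       (if (k < i)%N then (- c i / c k) *: apow mul a (i - k).-1 else 0).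
    apply: (big_morph (mul (apow mul a k)) (fun x y => cnaDr H _ x y)).
    by rewrite -(scale0r (0 : V)) (cnaZr H) !scale0r.
  have summand (i : 'I_n) : i != k -> mul (apow mul a k)
       (if (k < i)%N then (- c i / c k) *: apow mul a (i - k).-1 else 0)
     = (- (c k)^-1) *: (c i *: apow mul a i).
    move=> ik; case: ltnP => [ki|ki].
      rewrite (cnaZr H) (apow_mul _ _ _ (cnaA H)) scalerA -addnS prednK ?subn_gt0 //.
      rewrite subnKC; last exact: ltnW.
      by congr (_ *: _); ring.
    have ik' : (i < k)%N by rewrite ltn_neqAle ki andbT.
    rewrite (kmin i ik') scale0r scaler0.
    by rewrite -(scale0r (0 : V)) (cnaZr H) !scale0r.
  rewrite mul_sum (eq_bigr _ summand) -scaler_sumr.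
  move: c0; rewrite (bigD1 k) //= => /eqP; rewrite addr_eq0 => /eqP e.
  by rewrite -[X in _ *: X]opprK -e scalerN scaleNr opprK scalerA mulVf ?scale1r //; apply/eqP.
(* [q] is a modular unit of (1 - q) A, so q = v - q v for some v, and a^(k+1) = a^(k+1) q = a^(k+1)
   v - a^(k+1) q v = 0. *)
pose J := ideal_add_resolvent mul (fun x => x = 0) 1 q.
have JI : is_ideal mul J := ideal_add_resolventP H 1 q (zero_ideal H).
have Jq x : J (x - mul x q).
  by rewrite (cnaC H) -(scale1r (mul q x)); exact: (resolvent_sub_ideal _ _ _ (zero_ideal H)).
have [v [_ [-> ]]] := no_proper_modular_ideal H dimV ad JI Jq.
rewrite addr0 scale1r => qE.
have pk0 : apow mul a k = 0.
  rewrite pq {1}qE (cnaDr H) -scaleN1r (cnaZr H) scaleN1r (cnaA H) -pq subrr.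
  by [].
have p0 m : apow mul a (k + m) = 0.
  elim: m => [|m IH]; first by rewrite addn0.
  by rewrite addnS /= IH -(scale0r (0 : V)) (cnaZr H) !scale0r.
have [y yP] := not_line dimV 0; apply: (yP 0); rewrite scale0r.
apply: nrm_small_eq0 => eps e0; have [z [m [km]]] := ad y eps k e0.
by rewrite -(subnKC km) p0 scaler0 subr0.
Qed.

Lemma weakly_amenable_of_late_dense a : comm_normed_algebra mul ->
  late_dense mul a -> weakly_amenable mul.
Proof.
move=> H ad D [[DDl DZl DDr DZr] [[M0 DM0] Dder]].
have [M [M1 DM]] : exists M, 0 <= M /\ forall x y, nrm (D x y) <= M * nrm x * nrm y.
  exists `|M0|; split=> // x y.
  rewrite -lecR !rmorphM /= -!nrmE (le_trans (DM0 x y)) // ler_wpM2r //.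
  by rewrite ler_wpM2r // lecR ler_norm.
have DBl x y z : D (x - y) z = D x z - D y z by rewrite DDl -scaleN1r DZl mulN1r.
have DBr x y z : D z (x - y) = D z x - D z y by rewrite DDr -scaleN1r DZr mulN1r.
(* With the shift of [apow] this is (D a^(n+1))(a^(k+1)) = (n+1) (D a)(a^(n+k+1)), by the derivation
   identity and commutativity. *)
have Dpow n k : D (apow mul a n) (apow mul a k) = n.+1%:R * D a (apow mul a (n + k)).
  elim: n k => [|n IH] k; first by rewrite mul1r.
  rewrite [apow mul a n.+1]/= Dder (apow_mul _ _ _ (cnaA H)) (cnaC H (apow mul a k)).
  rewrite (apow_mul a 0 k (cnaA H)) IH addnS -[n.+2]add1n natrD mulrDl mul1r.
  by rewrite addSn.
have Da0 x : D a x = 0.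
  apply: nrm_small_eq0 => eps e0.
  pose B := M * (nrm x + 1) * nrm a.
  have B0 : 0 <= B by rewrite !mulr_ge0 ?nrm_ge0 // addr_ge0 // nrm_ge0.
  have [n0 n0P] := exists_nat_gt (2 * B / eps).
  have K0 : 0 < 2 * (M * nrm a + 1) by rewrite mulr_gt0 // ltr_wpDl // mulr_ge0 ?nrm_ge0.
  pose d := Num.min 1 (eps / (2 * (M * nrm a + 1))).
  have d0 : 0 < d by rewrite lt_min ltr01 divr_gt0.
  have [d1 d2] : d <= 1 /\ d <= eps / (2 * (M * nrm a + 1)).
    by split; rewrite ge_min lexx ?orbT.
  have [z [n [nn zn]]] := ad x _ n0 d0.
  set y := z *: apow mul a n in zn.
  (* Exchanging the arguments: (n + 1) (D a)(y) = (D y)(a), which is bounded independently of [n] as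
     [y] is near [x]. *)
  have Dy : D y a = n.+1%:R * D a y.
    by rewrite DZl (Dpow n 0%N) addn0 DZr mulrCA.
  have h1 : n.+1%:R * nrm (D a y) <= B.
    rewrite -(nrm_nat R) -nrmM -Dy; apply: le_trans (DM _ _) _.
    rewrite /B ler_wpM2r ?nrm_ge0 // ler_wpM2l //.
    have := nrmD (- (x - y)) x; rewrite nrmN opprB subrK; lra.
  have h2 : nrm (D a y) < eps / 2.
    rewrite ltr_pdivrMr // in n0P.
    have nR : 0 < n.+1%:R :> R by [].
    have nle : n0%:R <= n.+1%:R :> R by rewrite ler_nat (leq_trans nn).
    rewrite -(ltr_pM2l nR); apply: le_lt_trans h1 _; nra.
  have h3 := DM a (x - y); rewrite DBr in h3.
  rewrite ler_pdivlMr // in d2.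
  have h4 := nrmD (D a x - D a y) (D a y); rewrite subrK in h4.
  have h5 : M * nrm a * nrm (x - y) <= M * nrm a * d.
    by rewrite ler_wpM2l ?mulr_ge0 ?nrm_ge0 // ltW.
  lra.
have ad' x eps : 0 < eps -> exists (z : R[i]) n, nrm (x - z *: apow mul a n) < eps.
  by move=> e0; have [z [n [_ zn]]] := ad x eps 0%N e0; exists z, n.
have D0 x y : D x y = 0.
  have Dp n y' : D (apow mul a n) y' = 0.
    move: y'; apply: (@dense_eq0 _ a _ (M * nrm (apow mul a n)) ad') => [s t|s|z m].
    - exact: DBr.
    - exact: DM.
    - by rewrite DZr Dpow Da0 !mulr0.
  move: x; apply: (@dense_eq0 _ a _ (M * nrm y) ad') => [s t|s|z m].
  - exact: DBl.
  - by rewrite mulrAC; exact: DM.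
  - by rewrite DZl Dp mulr0.
exists (fun=> 0); split; last by move=> x y; rewrite D0 subrr.
split=> [x y|z x|]; rewrite ?addr0 ?mulr0 //.
by exists 0 => x; rewrite normr0 mul0r.
Qed.

End Supercyclic.

Theorem theorem1p3 (R : realType) (V : completeNormedModType R[i])
  (mul : V -> V -> V) :
  is_banach_algebra mul -> supercyclic mul -> dim_gt1 V ->
  infinite_dim V /\ radical mul /\ weakly_amenable mul.
Proof.
move=> mulP sc dimV; have [a ad] := supercyclic_approx sc.
have H := supercyclic_comm mulP ad; have la := approx_late_dense dimV ad.
split; first exact: (infinite_dim_of_no_modular H dimV la).
split; last exact: (weakly_amenable_of_late_dense H la).
(* By commutativity a maximal modular left ideal is an ideal, so it contains its modular unit and
   with it every element. *)
rewrite /radical -subTset => x _ L [[[L0 LD LZ LM] [u Lu]] _ _].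
have LI : is_ideal mul L.
  by split=> // y z Ly; rewrite (cnaC H); exact: LM.
exact: (modular_full H LI Lu (no_proper_modular_ideal H dimV la LI Lu)).
Qed.
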